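(* Assume complete randomization with a non-uniform design, Condition 1 (constant $\sigma_F$), Condition 2 (constants $c,c'$), $Q\ge2(c^2/c')H|\mathcal Q_{\mathrm L}|$, $N\le KQ$ for a constant $K$, and $S(q,q)>0$ for all $q$. Let $T=(\hat\gamma-\gamma)^\top V_{\hat\gamma}^{-1}(\hat\gamma-\gamma)$ and $T_0\sim\chi^2(H)$. Then there is a constant $C>0$ depending only on $c,c',\overline n,\underline c,\sigma_F,K$ such that $$\sup_{t\in\mathbb R}|\mathbb P(T\le t)-\mathbb P(T_0\le t)|\le C\frac{\max_{q\in[Q]}M_N(q)^3}{\{\min_{q\in\mathcal Q_{\mathrm S}}S(q,q)\}^{3/2}}\cdot\frac{H^{19/4}}{N^{1/2}}.$$
   Context: Randomization model: there are $N$ units and $Q$ treatment levels with prescribed group sizes $N_1,\dots,N_Q\ge1$, $\sum_{q=1}^QN_q=N$. Each unit $i\in[N]$ has fixed real potential outcomes $Y_i(1),\dots,Y_i(Q)$. Under complete randomization the treatment vector $Z=(Z_1,\dots,Z_N)$ is uniformly distributed over all vectors in $[Q]^N$ having exactly $N_q$ coordinates equal to $q$ for each $q$; the observed outcome is $Y_i=Y_i(Z_i)$. Write $\overline Y(q)=N^{-1}\sum_iY_i(q)$, $\overline Y=(\overline Y(q))_q$, $S(q,q')=(N-1)^{-1}\sum_i(Y_i(q)-\overline Y(q))(Y_i(q')-\overline Y(q'))$, $S=(S(q,q'))$, $\hat Y_q=N_q^{-1}\sum_{i:Z_i=q}Y_i$, $\hat Y=(\hat Y_q)_q$, $V_{\hat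 Y}=\mathrm{diag}(N_q^{-1}S(q,q))_{q\in[Q]}-N^{-1}S$. For a fixed $F=(f_{qh})\in\mathbb R^{Q\times H}$ let $\gamma=F^\top\overline Y$, $\hat\gamma=F^\top\hat Y$, $V_{\hat\gamma}=F^\top V_{\hat Y}F$ (assumed nonsingular), $M_N(q)=\max_i|Y_i(q)-\overline Y(q)|$, $\|F\|_\infty=\max_{q,h}|f_{qh}|$, $\varrho_{\min}$ the smallest eigenvalue. Non-uniform design: $[Q]=\mathcal Q_{\mathrm S}\cup\mathcal Q_{\mathrm L}$ (disjoint), where there are a positive integer $N_0$ and constants $0<\underline c\le\overline c$ with $N_q=c_qN_0$, $\underline c\le c_q\le\overline c$ for $q\in\mathcal Q_{\mathrm L}$, and a fixed integer $\overline n$ with $N_q\le\overline n$ for $q\in\mathcal Q_{\mathrm S}$. $\mathcal Q_{\mathrm S}$ is further split into $\mathcal Q_{\mathrm U}=\{q:N_q=1\}$ and $\mathcal Q_{\mathrm R}=\{q:2\le N_q\le\overline n\}$. For $\star\in\{\mathrm S,\mathrm U,\mathrm R,\mathrm L\}$, $N_\star=\sum_{q\in\mathcal Q_\star}N_q$. Condition 1: there exists $\sigma_F\ge1$ with $F^\top\mathrm{diag}(N_q^{-1}S(q,q))F\preceq\sigma_F^2F^\top V_{\hat Y}F$. Condition 2: there are constants $c,c'>0$ with $\|F\|_\infty\le cQ^{-1}$ and $\varrho_{\min}(F^\top F)\ge c'Q^{-1}$. *)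

(* Defs.v *)
From HB Require Import structures.
From mathcomp Require Import all_boot all_order all_algebra.
From mathcomp Require Import all_classical all_reals all_analysis.
Set Implicit Arguments. Unset Strict Implicit. Unset Printing Implicit Defensive.
Import Order.TTheory GRing.Theory Num.Theory.
Local Open Scope ring_scope.

Section Randomization.
Variables (R : realType) (N Q : nat).
Variable Nq : 'I_Q -> nat.
Variable Y : 'I_N -> 'I_Q -> R.

Definition admissible (Z : {ffun 'I_N -> 'I_Q}) : bool :=
  [forall q, #|[set i | Z i == q]| == Nq q].

Definition Ybar (q : 'I_Q) : R := N%:R^-1 * \sum_i Y i q.

Definition Ybar_vec : 'cV[R]_Q := \col_q Ybar q.

Definition Scov (q q' : 'I_Q) : R :=
  (N.-1)%:R^-1 * \sum_i (Y i q - Ybar q) * (Y i q' - Ybar q').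

Definition Smx : 'M[R]_Q := \matrix_(q, q') Scov q q'.

Definition VYhat : 'M[R]_Q :=
  diag_mx (\row_q ((Nq q)%:R^-1 * Scov q q)) - N%:R^-1 *: Smx.

Definition Yhat (Z : {ffun 'I_N -> 'I_Q}) : 'cV[R]_Q :=
  \col_q ((Nq q)%:R^-1 * \sum_(i | Z i == q) Y i q).

Variables (H : nat) (F : 'M[R]_(Q, H)).

Definition gamma : 'cV[R]_H := F^T *m Ybar_vec.
Definition gammahat Z : 'cV[R]_H := F^T *m Yhat Z.
Definition Vgammahat : 'M[R]_H := F^T *m VYhat *m F.

Definition Tstat Z : R :=
  ((gammahat Z - gamma)^T *m invmx Vgammahat *m (gammahat Z - gamma)) 0 0.

Definition prob_T_le (t : R) : R :=
  #|[set Z | admissible Z & Tstat Z <= t]|%:R / #|[set Z | admissible Z]|%:R.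

Definition MN (q : 'I_Q) : R := \big[Num.max/0]_i `|Y i q - Ybar q|.

End Randomization.

Definition loewner_le (R : realType) (n : nat) (A B : 'M[R]_n) : Prop :=
  forall x : 'cV[R]_n, 0 <= (x^T *m (B - A) *m x) 0 0.

Definition mx_supnorm (R : realType) (m n : nat) (F : 'M[R]_(m, n)) : R :=
  \big[Num.max/0]_(i < m) \big[Num.max/0]_(j < n) `|F i j|.

(* minimum of f over a nonempty finite set A (default value irrelevant
   when A is nonempty: it is the max of f over the whole type) *)
Definition max_all (R : realType) (T : finType) (f : T -> R) : R :=
  \big[Num.max/0]_(x : T) f x.
Definition min_over (R : realType) (T : finType) (A : {set T}) (f : T -> R) : R :=
  \big[Num.min/max_all f]_(x in A) f x.

(* Chi-square distribution with H degrees of freedom: CDF obtained from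
   the density proportional to x^{H/2-1} e^{-x/2} on (0, +oo). *)
Definition chi2_dens (R : realType) (H : nat) (x : R) : R :=
  if 0 < x then x `^ (H%:R / 2 - 1) * expR (- x / 2) else 0.

Definition chi2_cdf (R : realType) (H : nat) (t : R) : R :=
  fine (\int[lebesgue_measure]_(x in [set` `]-oo, t]]) (chi2_dens H x)%:E)
  / fine (\int[lebesgue_measure]_(x in [set: R]) (chi2_dens H x)%:E).

(* Main.v *)
Require Import Defs.
From HB Require Import structures.
From mathcomp Require Import all_boot all_order all_algebra all_fingroup.
From mathcomp Require Import all_classical all_reals all_analysis.
From mathcomp Require Import measurable_realfun ring lra.
Set Implicit Arguments. Unset Strict Implicit. Unset Printing Implicit Defensive.
Import Order.TTheory GRing.Theory Num.Theory.
Import numFieldNormedType.Exports.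
Local Open Scope classical_set_scope.
Local Open Scope ring_scope.

(** With [Z] the treatment vector, the deviation [U = gammahat - gamma] is a
    sum of vectors [al i (Z i)], and [T = |U|^2] for the inner product given by
    the inverse of its covariance. As the target law of [|U|^2] is chi-square
    whatever the direction of [U], only the one-dimensional Stein equation
    [2 x psi'(x) + (H - x) psi(x) = f(x) - E f] is needed; it is explicitly
    solvable. Exchanging the labels of two units gives an exchangeable pair,
    and averaging over two prescribed units taking their labels from two
    arbitrary ones makes the distribution of the exchanged labels
    deterministic, so that the second-order term of the expansion is exactly
    [H psi + 2 x psi'] up to the variation of [psi] over distance
    [12 max |al i q|]. The tests [f] are ramps of [P x], [P] the chi-square
    distribution function. The error involves the probability that [P(|U|^2)]
    lies in short intervals, which is bounded by the Kolmogorov distance itself;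
    the latter is thus at most a quarter of itself plus the desired bound.
    Conditions 1 and 2 bound every [|al i q|]. *)

(** The delicate point is the origin: the second-order term contains the squared cosine of the angle
    between [U] and the increment, which varies at rate [1 / |u|]. It is multiplied by [2 x psi'(x)]
    at [x = |u|^2], and this quantity is at most of order [|u|] as long as [P x <= a], so that the
    product varies at a bounded rate. Elsewhere the slope contains a term of order [m / P^2], where
    [m] is the mean of the ramp from [a] to [b]. As [m] is of the order of [a], that term has
    bounded mean when [P] is nearly uniform. This explains why ramps are no wider than [a], and why
    the Kolmogorov distance enters a second time, through the mean of [P^-2]. What comes out is of
    order [H^(7/2) N^(-1/2) M / sqrt s], with [M] the largest deviation and [s] the smallest
    variance over the small groups; as [s <= 2 M^2] and [1 <= H], the cube and the exponent [19/4]
    follow. *)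

Section RealDerivatives.
Variable R : realType.
Implicit Types (f g : R -> R) (x a b : R).

Lemma is_derive1_eq f x a b : is_derive x 1 f a -> a = b -> is_derive x 1 f b.
Proof. by move=> fa <-. Qed.

Lemma is_derive1_id x : is_derive x 1 (fun t : R => t) 1.
Proof. exact: is_derive_id. Qed.

Lemma is_derive1_cst k x : is_derive x 1 (fun _ : R => k : R) 0.
Proof. exact: is_derive_cst. Qed.

Lemma is_derive1D f g x a b : is_derive x 1 f a -> is_derive x 1 g b ->
  is_derive x 1 (fun t => f t + g t) (a + b).
Proof. exact: is_deriveD. Qed.

Lemma is_derive1B f g x a b : is_derive x 1 f a -> is_derive x 1 g b ->
  is_derive x 1 (fun t => f t - g t) (a - b).
Proof. exact: is_deriveB. Qed.

Lemma is_derive1N f x a : is_derive x 1 f a -> is_derive x 1 (fun t => - f t) (- a).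
Proof. exact: is_deriveN. Qed.

Lemma is_derive1M f g x a b : is_derive x 1 f a -> is_derive x 1 g b ->
  is_derive x 1 (fun t => f t * g t) (f x * b + g x * a).
Proof. exact: is_deriveM. Qed.

Lemma is_derive1Z k f x a : is_derive x 1 f a -> is_derive x 1 (fun t => k * f t) (k * a).
Proof. exact: is_deriveZ. Qed.

Lemma is_derive1V f x a : f x != 0 -> is_derive x 1 f a ->
  is_derive x 1 (fun t => (f t)^-1) (- (a / f x ^+ 2)).
Proof.
by move=> f0 fa; apply: is_derive1_eq (is_deriveV f0 fa) _; rewrite scaleNr mulrC.
Qed.

Lemma is_derive1_chain f g x a b : is_derive (g x) 1 f a -> is_derive x 1 g b ->
  is_derive x 1 (fun t => f (g t)) (a * b).
Proof. exact: is_derive1_comp. Qed.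

Lemma is_derive1_continuous f x a : is_derive x 1 f a -> {for x, continuous f}.
Proof.
by move=> fa; apply: differentiable_continuous; apply/derivable1_diffP; exact: ex_derive.
Qed.

End RealDerivatives.

(** * The chi-square distribution *)

Section ChiSquare.
Variable R : realType.
Implicit Types (x y : R) (H : nat).
Local Notation mu := (@lebesgue_measure R).

Lemma chi2_dens_ge0 H x : 0 <= chi2_dens H x.
Proof. by rewrite /chi2_dens; case: ifP => // _; rewrite mulr_ge0 ?powR_ge0 ?expR_ge0. Qed.

Lemma chi2_dens_gt0 H x : 0 < x -> 0 < chi2_dens H x.
Proof. by rewrite /chi2_dens => x0; rewrite x0 mulr_gt0 ?powR_gt0 ?expR_gt0. Qed.

Lemma measurable_chi2_dens H (D : set R) : measurable_fun D (@chi2_dens R H).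
Proof.
apply: measurable_funS (_ : measurable_fun setT _) => //.
apply: measurable_fun_ifT => //.
- exact: measurable_fun_ltr.
- apply: measurable_funM; first exact: measurable_powR.
  by apply: measurableT_comp => //; apply: measurable_funM => //; exact: measurableT_comp.
Qed.

Lemma is_derive_chi2_dens H x : 0 < x ->
  is_derive x 1 (@chi2_dens R H) (((H%:R / 2 - 1) / x - 2^-1) * chi2_dens H x).
Proof.
move=> x0.
have d1 : is_derive x 1 (fun t : R => t `^ (H%:R / 2 - 1) * expR (- t / 2))
   (((H%:R / 2 - 1) / x - 2^-1) * chi2_dens H x).
  have dp := is_derive1_powR (H%:R / 2 - 1) x0.
  have de : is_derive x 1 (fun t : R => expR (- t / 2)) (expR (- x / 2) * (- 2^-1)).
    apply: is_derive1_chain.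
    apply: is_derive1_eq (is_derive1M (is_derive1N (is_derive1_id x)) (is_derive1_cst 2^-1 x)) _.
    by rewrite mulr0 add0r mulrN1.
  apply: is_derive1_eq (is_derive1M dp de) _; rewrite /chi2_dens x0.
  rewrite (_ : x `^ (H%:R / 2 - 1) = x * x `^ (H%:R / 2 - 1 - 1)).
    by field; rewrite gt_eqF.
  rewrite -{2}(powRr1 (ltW x0)) -powRD; last by rewrite (gt_eqF x0) implybT.
  by congr (_ `^ _); ring.
apply: near_eq_is_derive d1.
near=> t; rewrite /chi2_dens.
suff -> : 0 < t by [].
by near: t; exact: lt_nbhsr.
Unshelve. all: by end_near. Qed.

Lemma continuous_chi2_dens H x : 0 < x -> {for x, continuous (@chi2_dens R H)}.
Proof. by move=> x0; exact: is_derive1_continuous (is_derive_chi2_dens H x0). Qed.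

(* An integrable majorant of the density with an elementary primitive, [G] below. *)
Let g x := x `^ (- 2^-1) * expR (- (x `^ (2^-1))).

Lemma exprn_le_fact_expR n y : 0 <= y -> y ^+ n <= n`!%:R * expR y.
Proof.
move=> y0; case: n => [|n]; first by rewrite expr0 mul1r -expR0 ler_expR.
have := expR_ge1Dxn n y0; rewrite [_ * expR y]mulrC => h.
rewrite -ler_pdivrMr ?ltr0n ?fact_gt0 //; lra.
Qed.

(** With [y = sqrt x], the power [y^(H-1)] is at most [(H-1)! e^y], and the exponents compare by
    [y - y^2 / 2 <= 2 - y], that is [(y - 2)^2 >= 0]. *)
Let dens_le_g H x : (0 < H)%N -> 0 < x ->
  chi2_dens H x <= (H.-1`!%:R * expR 2) * g x.
Proof.
move=> H0 x0; rewrite /chi2_dens x0 /g.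
set y := x `^ (2^-1).
have y0 : 0 <= y by exact: powR_ge0.
have xy : x = y ^+ 2.
  by rewrite -powR_mulrn // -powRrM mulVf ?powRr1 // ltW.
have -> : x `^ (H%:R / 2 - 1) = x `^ (- 2^-1) * y ^+ H.-1.
  rewrite -powR_mulrn // /y -powRrM -powRD; last by rewrite (gt_eqF x0) implybT.
  by congr (_ `^ _); rewrite -{1}(prednK H0) -natr1; field.
rewrite -mulrA [leRHS]mulrCA ler_wpM2l ?powR_ge0 //.
apply: (@le_trans _ _ (H.-1`!%:R * expR y * expR (- x / 2))).
  by rewrite ler_wpM2r ?expR_ge0 // exprn_le_fact_expR.
rewrite -!mulrA ler_wpM2l // -!expRD ler_expR xy.
by have := sqr_ge0 (y - 2); nra.
Qed.

Let G x := - 2 * expR (- (x `^ (2^-1))).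
Let dG x : 0 < x -> is_derive x 1 G (g x).
Proof.
move=> x0; have dp := is_derive1N (is_derive1_powR (2^-1) x0).
apply: is_derive1_eq (is_derive1Z _ (is_derive1_chain (is_derive_expR _) dp)) _.
by rewrite /g (_ : 2^-1 - 1 = - 2^-1 :> R); [field | field].
Qed.

Let cg x : 0 < x -> {for x, continuous g}.
Proof.
move=> x0; apply: (@continuousM _ R).
  exact: (is_derive1_continuous (is_derive1_powR (- 2^-1) x0)).
have dp := is_derive1N (is_derive1_powR (2^-1) x0).
exact: (is_derive1_continuous (is_derive1_chain (is_derive_expR _) dp)).
Qed.

Let bound_itv H (a b : R) : (0 < H)%N -> 0 < a -> a < b ->
  (\int[mu]_(x in `[a, b]) (chi2_dens H x)%:E <= (2 * (H.-1`!%:R * expR 2))%:E)%E.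
Proof.
move=> H0 a0 ab; set C := _ * expR 2.
have C0 : 0 <= C by rewrite mulr_ge0 ?expR_ge0.
have dCG x : 0 < x -> is_derive x 1 (fun t => C * G t) (C * g x).
  by move=> x0; exact: is_derive1Z (dG x0).
have cCG x : 0 < x -> {for x, continuous (fun t => C * G t)}.
  by move=> x0; exact: (is_derive1_continuous (dCG x x0)).
have cCg x : 0 < x -> {for x, continuous (fun t => C * g t)}.
  by move=> x0; apply: (@continuousM _ R); [exact: cst_continuous | exact: cg].
have wc : {within `[a, b], continuous (fun t => C * g t)}.
  apply: continuous_in_subspaceT => x; rewrite inE/= in_itv/= => /andP[ax _].
  by apply: cCg; lra.
apply: (@le_trans _ _ (\int[mu]_(x in `[a, b]) (C * g x)%:E)%E).
  apply: ge0_le_integral => //=.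
  - by move=> x _; rewrite lee_fin chi2_dens_ge0.
  - by apply/measurable_EFinP; exact: measurable_chi2_dens.
  - apply/measurable_EFinP; exact: subspace_continuous_measurable_fun.
  - move=> x; rewrite in_itv/= => /andP[ax _]; rewrite lee_fin dens_le_g //.
    by lra.
rewrite (@continuous_FTC2 _ _ (fun t => C * G t)) //.
- rewrite -EFinB lee_fin /G -mulrBr mulrC ler_wpM2r //.
  have e1 : expR (- a `^ 2^-1) <= 1 by rewrite -expR0 ler_expR oppr_le0 powR_ge0.
  by have := expR_ge0 (- b `^ 2^-1); lra.
- split.
  + by move=> x; rewrite in_itv/= => /andP[ax _]; exact: (@ex_derive _ _ _ _ _ _ _ (dCG x (lt_trans a0 ax))).
  + by apply: cvg_at_right_filter; exact: cCG.
  + by apply: cvg_at_left_filter; apply: cCG; lra.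
- move=> x; rewrite in_itv/= => /andP[ax _].
  by rewrite derive1E; apply: derive_val; apply: dCG; lra.
Qed.

(** The halved left end keeps the interval nondegenerate at [n = 0] as well. *)
Let Fn n : set R := `[n.+1%:R^-1 / 2, n.+1%:R].

Let Fn_cup : \bigcup_n Fn n = `]0, +oo[%classic.
Proof.
apply/seteqP; split => x /=.
  move=> [n _]; rewrite /Fn/= !in_itv/= => /andP[h _]; rewrite andbT.
  by apply: lt_le_trans h; rewrite divr_gt0 // invr_gt0 ltr0n.
rewrite in_itv/= andbT => x0.
have [n hn] : exists n : nat, x + x^-1 <= n%:R.
  exists (Num.trunc (x + x^-1)).+1; apply/ltW.
  exact: truncnS_gt.
exists n => //; rewrite /Fn/= in_itv/=; apply/andP; split.
  have xi0 : 0 < x^-1 by rewrite invr_gt0.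
  have h1 : x^-1 <= n.+1%:R by rewrite -natr1; lra.
  have h2 : n.+1%:R^-1 <= x by rewrite invf_ple ?posrE.
  have : 0 < n.+1%:R^-1 :> R by rewrite invr_gt0.
  move: (n.+1%:R^-1) h2 => z; lra.
by have : 0 < x^-1 by [rewrite invr_gt0]; rewrite -natr1; lra.
Qed.

Let Fn_nd : nondecreasing_seq Fn.
Proof.
move=> m n mn; rewrite subsetEset => x; rewrite /Fn/= !in_itv/= => /andP[h1 h2].
apply/andP; split.
  apply: le_trans h1; rewrite ler_wpM2r // lef_pV2 ?posrE //.
  by rewrite ler_nat.
by apply: le_trans h2 _; rewrite ler_nat.
Qed.

Let cvg_Fn H : (\int[mu]_(x in Fn i) (chi2_dens H x)%:E)%E @[i --> \oo] -->
  (\int[mu]_(x in `]0%R, +oo[) (chi2_dens H x)%:E)%E.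
Proof.
rewrite -Fn_cup; apply: ge0_nondecreasing_set_cvg_integral => //.
- by move=> i; exact: measurable_itv.
- by move=> i; apply/measurable_EFinP; exact: measurable_chi2_dens.
- by move=> i x _; rewrite lee_fin chi2_dens_ge0.
Qed.

Let int_pos H (D : set R) : measurable D ->
  (\int[mu]_(x in D) (chi2_dens H x)%:E = \int[mu]_(x in D `&` `]0%R, +oo[) (chi2_dens H x)%:E)%E.
Proof.
move=> mD; rewrite integral_mkcondr; apply: eq_integral => x _.
rewrite patchE; case: ifPn => // /negP; rewrite inE /= in_itv/= andbT => /negP.
by rewrite /chi2_dens => /negbTE ->.
Qed.

Definition chi2_norm H : R := fine (\int[mu]_x (chi2_dens H x)%:E)%E.
Local Notation Z := chi2_norm.

Lemma integrable_chi2_dens H : (0 < H)%N -> mu.-integrable setT (EFin \o @chi2_dens R H).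
Proof.
move=> H0; apply/integrableP; split.
  by apply/measurable_EFinP; exact: measurable_chi2_dens.
under eq_integral do rewrite /= ger0_norm ?chi2_dens_ge0 //.
rewrite int_pos // setTI.
apply: (@le_lt_trans _ _ (2 * (H.-1`!%:R * expR 2))%:E); last exact: ltry.
rewrite -(cvg_lim _ (@cvg_Fn H)) //.
apply: lime_le; first by apply: cvgP; exact: (@cvg_Fn H).
near=> n; apply: bound_itv => //.
have h : n.+1%:R^-1 <= 1 :> R by rewrite invf_le1 // ler1n.
have : 1 <= n.+1%:R :> R by rewrite ler1n.
move: (n.+1%:R^-1) h => z.
by lra.
Unshelve. all: by end_near. Qed.

Let intE H (D : set R) : (0 < H)%N -> measurable D ->
  (\int[mu]_(x in D) (chi2_dens H x)%:E)%E = (\int[mu]_(x in D) chi2_dens H x)%:E.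
Proof.
move=> H0 mD; rewrite /Rintegral fineK //; apply: integrable_fin_num => //.
by apply: integrableS (integrable_chi2_dens H0).
Qed.

Let cdfE H x : chi2_cdf H x = (\int[mu]_(t in `]-oo, x]) chi2_dens H t) / Z H.
Proof. by []. Qed.

Let Rint_le H (A B : set R) : (0 < H)%N -> measurable A -> measurable B -> A `<=` B ->
  \int[mu]_(x in A) chi2_dens H x <= \int[mu]_(x in B) chi2_dens H x.
Proof.
move=> H0 mA mB AB; rewrite -lee_fin -!intE //; apply: ge0_subset_integral => //.
- by apply/measurable_EFinP; exact: measurable_chi2_dens.
- by move=> x _; rewrite lee_fin chi2_dens_ge0.
Qed.

Let Rint_derive H x : (0 < H)%N -> 0 < x ->
  is_derive x 1 (fun y => \int[mu]_(t in `]-oo, y]) chi2_dens H t) (chi2_dens H x).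
Proof.
move=> H0 x0.
have [||||d1 d2] := @continuous_FTC1 R (@chi2_dens R H) -oo%O x (x + 1).
- by lra.
- by apply: integrableS (integrable_chi2_dens H0).
- by rewrite ltNyr.
- exact: continuous_chi2_dens.
by apply: DeriveDef; [exact: d1 | rewrite -d2 derive1E].
Qed.

(** The mean value theorem on [[1, 2]] exhibits positive mass there, without evaluating the constant
    as a Gamma function. *)
Lemma chi2_norm_gt0 H : (0 < H)%N -> 0 < Z H.
Proof.
move=> H0; pose I y := \int[mu]_(t in `]-oo, y]) chi2_dens H t.
have [c] : exists2 c, c \in `]1, 2[%R & I 2 - I 1 = chi2_dens H c * (2 - 1).
  apply: MVT => [|x|]; first by lra.
    by rewrite in_itv/= => /andP[? _]; apply: Rint_derive => //; lra.
  apply: continuous_in_subspaceT => x; rewrite inE/= in_itv/= => /andP[ax _].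
  by apply: is_derive1_continuous; apply: Rint_derive => //; lra.
rewrite in_itv/= => /andP[c1 c2] e.
have I1 : 0 <= I 1 by apply: Rintegral_ge0 => x _; exact: chi2_dens_ge0.
have I2 : I 2 <= Z H by apply: Rint_le.
have := @chi2_dens_gt0 H c; rewrite -/(Z H); lra.
Qed.

Lemma chi2_cdf_le0 H x : x <= 0 -> chi2_cdf H x = 0.
Proof.
move=> x0; rewrite cdfE /Rintegral integral0_eq ?mul0r // => t /=.
rewrite in_itv/= => tx; rewrite /chi2_dens ifF //; apply/negbTE; rewrite -leNgt; lra.
Qed.

Lemma is_derive_chi2_cdf H x : (0 < H)%N -> 0 < x ->
  is_derive x 1 (@chi2_cdf R H) (chi2_dens H x / Z H).
Proof.
move=> H0 x0; have := is_derive1Z (Z H)^-1 (Rint_derive H0 x0); rewrite [_ * chi2_dens _ _]mulrC.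
rewrite (_ : (fun _ => _) = @chi2_cdf R H) //.
by apply/funext => t /=; rewrite cdfE mulrC.
Qed.

Lemma chi2_cdf_ge0 H x : (0 < H)%N -> 0 <= chi2_cdf H x.
Proof.
move=> H0; rewrite cdfE divr_ge0 ?(ltW (chi2_norm_gt0 H0)) //.
by apply: Rintegral_ge0 => t _; exact: chi2_dens_ge0.
Qed.

Lemma chi2_cdf_le1 H x : (0 < H)%N -> chi2_cdf H x <= 1.
Proof. by move=> H0; rewrite cdfE ler_pdivrMr ?chi2_norm_gt0 // mul1r; exact: Rint_le. Qed.

Lemma le_chi2_cdf H x y : (0 < H)%N -> x <= y -> chi2_cdf H x <= chi2_cdf H y.
Proof.
move=> H0 xy; rewrite !cdfE ler_pM2r ?invr_gt0 ?chi2_norm_gt0 //.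
by apply: Rint_le => // t /=; rewrite !in_itv/= => tx; lra.
Qed.

Lemma chi2_cdf_near0 H (e : R) : (0 < H)%N -> 0 < e ->
  exists2 d, 0 < d & chi2_cdf H d < e.
Proof.
move=> H0 e0; have Z0 := chi2_norm_gt0 H0.
have [d [d0 hd]] := integral_normr_continuous (integrable_chi2_dens H0) (mulr_gt0 e0 Z0).
exists (d / 2); first by lra.
rewrite cdfE ltr_pdivrMr //.
have -> : \int[mu]_(t in `]-oo, d / 2]) chi2_dens H t =
  \int[mu]_(t in `]0, d / 2]) `|chi2_dens H t|.
  rewrite /Rintegral int_pos //.
  rewrite (_ : `]-oo, d / 2] `&` `]0, +oo[ = `]0, d / 2])%classic; last first.
    by apply/seteqP; split => x /=; rewrite !in_itv/= andbT; [case=> -> -> | case/andP=> -> ->].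
  by congr fine; apply: eq_integral => x _; rewrite ger0_norm ?chi2_dens_ge0.
apply: hd; first exact: measurable_itv.
have /= -> := lebesgue_measure_itv `]0, (d / 2)%R]; rewrite lte_fin divr_gt0 //.
by rewrite -EFinB lte_fin; lra.
Qed.

Lemma chi2_cdf_nearoo H (e : R) : (0 < H)%N -> 0 < e ->
  exists y, 1 - e < chi2_cdf H y.
Proof.
move=> H0 e0; have Z0 := chi2_norm_gt0 H0.
have := @cvg_Fn H; rewrite (_ : (\int[mu]_(x in `]0%R, +oo[) (chi2_dens H x)%:E)%E = (Z H)%:E); last first.
  by rewrite -[X in integral _ X]setTI -int_pos // intE.
move/fine_cvg; rewrite /= => /cvgrPdist_lt /(_ _ (mulr_gt0 e0 Z0))[n _ /(_ n)] /= /(_ (leqnn n)).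
move=> h; exists n.+1%:R; rewrite cdfE ltr_pdivlMr //.
have : \int[mu]_(t in Fn n) chi2_dens H t <= \int[mu]_(t in `]-oo, n.+1%:R]) chi2_dens H t.
  apply: Rint_le => //; first exact: measurable_itv.
  by rewrite /Fn => t /=; rewrite !in_itv/= => /andP[].
move: h; rewrite /Rintegral; set A := fine _; set B := fine _ => h hB.
have := ler_norm (Z H - A); lra.
Qed.

End ChiSquare.

(** * Monotonicity, limiting inequalities and quadratic approximation *)

Section RealCalculus.
Variable R : realType.
Implicit Types (f df : R -> R) (x y a b : R).

Lemma is_derive1_le f df a b : a <= b ->
  (forall x, a <= x <= b -> is_derive x 1 f (df x)) ->
  (forall x, a <= x <= b -> 0 <= df x) -> f a <= f b.
Proof.
move=> ab fd df0.
have [x||c] := MVT_segment (f := f) (df := df) ab.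
- by rewrite in_itv/= => /andP[ax xb]; apply: fd; lra.
- apply: continuous_in_subspaceT => x; rewrite inE/= in_itv/= => xab.
  by apply: is_derive1_continuous; apply: fd.
rewrite in_itv/= => cab e.
by rewrite -subr_ge0 e mulr_ge0 ?df0 // subr_ge0.
Qed.

(** Stands in for limits at 0 and at infinity: a monotone difference is compared with its value at a
    point where it exceeds [- e]. *)
Lemma ge0_of_nearly x : (forall e, 0 < e -> - e <= x) -> 0 <= x.
Proof.
move=> h; case: (leP 0 x) => // x0.
have := h (- x / 2); lra.
Qed.

(** Intended for the squared positive part, differentiable at its kink because the remainder is
    quadratic on both sides. *)
Lemma is_derive1_of_quadratic f x d (C : R) :
  (forall t, `|f (t + x) - f x - t * d| <= C * t ^+ 2) -> is_derive x 1 f d.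
Proof.
move=> h.
have C0 : 0 <= C by have := h 1; rewrite expr1n mulr1 => /(le_trans _); apply.
suff H : (fun t : R => t^-1 *: ((f \o shift x) (t *: (1 : R)) - f x)) @ 0^' --> d.
  by apply: DeriveDef; [apply/cvg_ex; exists d | apply: cvg_lim].
apply/cvgrPdist_le => /= e e0; near=> t.
have t0 : t != 0 by near: t; exact: nbhs_dnbhs_neq.
rewrite /GRing.scale/= mulr1.
have -> : d - t^-1 * (f (t + x) - f x) = - (t^-1 * (f (t + x) - f x - t * d)).
  by field.
rewrite normrN normrM normfV ler_pdivrMl ?normr_gt0 //.
apply: le_trans (h t) _.
have tC : `|t| <= e / (C + 1).
  by near: t; apply: dnbhs0_le; rewrite divr_gt0 // ltr_wpDl.
rewrite -real_normK ?num_real // expr2 mulrCA ler_wpM2l //.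
apply: le_trans (_ : C * (e / (C + 1)) <= _); first exact: ler_wpM2l.
rewrite mulrA ler_pdivrMr ?ltr_wpDl // mulrC; nra.
Unshelve. all: by end_near. Qed.

Lemma is_derive1_sqr x : is_derive x 1 (fun t : R => t ^+ 2) (2 * x).
Proof.
rewrite (_ : (fun t : R => t ^+ 2) = fun t => t * t); last by apply/funext => t; rewrite expr2.
apply: is_derive1_eq (is_derive1M (is_derive1_id x) (is_derive1_id x)) _.
by rewrite mulr1 mulr_natl.
Qed.

End RealCalculus.

(** * Inequalities between the chi-square distribution function and its Stein weight *)

Section ChiSquareBounds.
Variables (R : realType) (H : nat) (H_gt0 : (0 < H)%N).
Implicit Types (x y r s e : R).
Local Notation P := (@chi2_cdf R H).

Let p x := chi2_dens H x / chi2_norm R H.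

(* The integrating factor of the Stein equation: [w' x = (H - x) p x]. *)
Definition chi2_weight x : R := 2 * x * (chi2_dens H x / chi2_norm R H).
Local Notation w := chi2_weight.

Let Z0 : 0 < chi2_norm R H := chi2_norm_gt0 R H_gt0.
Let H1 : 1 <= H%:R :> R. Proof. by rewrite ler1n. Qed.
Let Hn0 : H%:R != 0 :> R. Proof. by rewrite pnatr_eq0 -lt0n. Qed.

Let p_gt0 x : 0 < x -> 0 < p x.
Proof. by move=> x0; rewrite divr_gt0 // chi2_dens_gt0. Qed.

Lemma chi2_weight_gt0 x : 0 < x -> 0 < w x.
Proof. by move=> x0; rewrite mulr_gt0 ?p_gt0 // mulr_gt0. Qed.

Let dP x : 0 < x -> is_derive x 1 P (p x).
Proof. exact: is_derive_chi2_cdf. Qed.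

Lemma is_derive_chi2_weight x : 0 < x -> is_derive x 1 w ((H%:R - x) * p x).
Proof.
move=> x0; have d1 := is_derive1M (is_derive_chi2_dens H x0) (is_derive1_cst (chi2_norm R H)^-1 x).
apply: is_derive1_eq (is_derive1M (is_derive1Z 2 (is_derive1_id x)) d1) _.
by rewrite /p; field; rewrite !gt_eqF.
Qed.

Lemma chi2_cdf_lt x y : 0 < x -> x < y -> P x < P y.
Proof.
move=> x0 xy; have [c||c] := MVT (f := P) (df := p) xy.
- by rewrite in_itv/= => /andP[? _]; apply: dP; lra.
- apply: continuous_in_subspaceT => z; rewrite inE/= in_itv/= => /andP[? _].
  by apply: (is_derive1_continuous (dP _)); lra.
rewrite in_itv/= => /andP[c1 c2] h.
have : 0 < p c by apply: p_gt0; lra.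
by nra.
Qed.

Lemma chi2_cdf_gt0 x : 0 < x -> 0 < P x.
Proof.
move=> x0; have : P (x / 2) < P x by apply: chi2_cdf_lt; lra.
by apply: le_lt_trans; exact: chi2_cdf_ge0.
Qed.

Let P_small x e : 0 < x -> 0 < e -> exists2 y, 0 < y <= x & P y <= e.
Proof.
move=> x0 e0; have [d d0 hd] := chi2_cdf_near0 H_gt0 e0.
exists (Num.min x d); first by rewrite lt_min x0 d0 ge_min lexx.
by apply: le_trans (ltW hd); apply: le_chi2_cdf => //; rewrite ge_min lexx orbT.
Qed.

Let w_sqrt_le x : 0 < x -> x <= 1 -> w x <= 2 / chi2_norm R H * Num.sqrt x.
Proof.
move=> x0 x1; rewrite /w /chi2_dens x0.
rewrite (_ : 2 * x * _ = 2 / chi2_norm R H * (x `^ (H%:R / 2) * expR (- x / 2))).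
  rewrite ler_pM2l ?divr_gt0 //.
  rewrite -powR12_sqrt; last exact: ltW.
  apply: le_trans (_ : x `^ (H%:R / 2) * 1 <= _).
    rewrite ler_wpM2l ?powR_ge0 // -[leRHS]expR0 ler_expR; lra.
  by rewrite mulr1; apply: ger_powR; [rewrite x0 x1 | have := H1; lra].
rewrite -(@mulr_powRB1 _ x (H%:R / 2)) ?ltW //; last by rewrite divr_gt0 // (lt_le_trans ltr01).
by field; rewrite gt_eqF.
Qed.

(** [H P - w] has derivative [x p >= 0], and [w] vanishes at 0. *)
Lemma chi2_weight_le_cdf x : 0 < x -> w x <= H%:R * P x.
Proof.
move=> x0; rewrite -subr_ge0; apply: ge0_of_nearly => e e0.
set C := 2 / chi2_norm R H.
have C0 : 0 < C by rewrite divr_gt0.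
(* [C] is the constant of [w_sqrt_le], so that [w y <= C sqrt y <= e]. *)
pose y := Num.min (Num.min 1 x) ((e / C) ^+ 2).
have eC : 0 < e / C by rewrite divr_gt0.
have y0 : 0 < y by rewrite !lt_min ltr01 x0 exprn_gt0.
have [y1 yx ye] : [/\ y <= 1, y <= x & y <= (e / C) ^+ 2].
  by rewrite !ge_min !lexx /= ?orbT.
have wy : w y <= e.
  apply: le_trans (w_sqrt_le y0 y1) _; rewrite -/C mulrC -ler_pdivlMr //.
  by rewrite -(ger0_norm (ltW eC)) -sqrtr_sqr ler_wsqrtr.
have mono : H%:R * P y - w y <= H%:R * P x - w x.
  apply: (is_derive1_le (f := fun t => H%:R * P t - w t)
    (df := fun t => H%:R * p t - (H%:R - t) * p t)) => [//||].
    move=> t tb; apply: is_derive1B; first by apply: is_derive1Z; apply: dP; lra.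
    by apply: is_derive_chi2_weight; lra.
  move=> t tb; have : 0 < p t by apply: p_gt0; lra.
  by nra.
have : 0 <= H%:R * P y by rewrite mulr_ge0 ?chi2_cdf_ge0.
by move: mono wy; lra.
Qed.

(** The derivative of [w - (H - x) P] is [P]. *)
Lemma chi2_cdf_le_weight x : 0 < x -> (H%:R - x) * P x <= w x.
Proof.
move=> x0; rewrite -subr_ge0; apply: ge0_of_nearly => e e0.
have [y /andP[y0 yx] Py] := P_small x0 (divr_gt0 e0 (lt_le_trans ltr01 H1)).
have mono : w y - (H%:R - y) * P y <= w x - (H%:R - x) * P x.
  apply: (is_derive1_le (f := fun t => w t - (H%:R - t) * P t)
    (df := fun t => (H%:R - t) * p t - ((H%:R - t) * p t + P t * (0 - 1)))) => [//||].
    move=> t tb; apply: is_derive1B; first by apply: is_derive_chi2_weight; lra.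
    apply: is_derive1M; last by apply: dP; lra.
  by move=> t tb; have := chi2_cdf_ge0 t H_gt0; nra.
have := chi2_weight_gt0 y0; have P0 := chi2_cdf_ge0 y H_gt0.
have : H%:R * P y <= e by rewrite mulrC -ler_pdivlMr // (lt_le_trans ltr01).
by move: mono; nra.
Qed.

(** With the factor [x - H] frozen, [- w t - (x - H) P t] has derivative [(t - x) p t], nonnegative
    beyond [x]; a point [y] with a small tail replaces infinity. *)
Lemma chi2_tail_le_weight x : 0 < x -> (x - H%:R) * (1 - P x) <= w x.
Proof.
move=> x0; case: (leP x H%:R) => [xH|xH].
  by have := chi2_cdf_le1 x H_gt0; have := chi2_weight_gt0 x0; nra.
rewrite -subr_ge0; apply: ge0_of_nearly => e e0.
have xH' : 0 < x - H%:R by lra.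
have [y0 hy0] := chi2_cdf_nearoo H_gt0 (divr_gt0 e0 xH').
pose y := Num.max x y0.
have xy : x <= y by rewrite le_max lexx.
have Py : 1 - e / (x - H%:R) < P y.
  by apply: lt_le_trans hy0 _; apply: le_chi2_cdf => //; rewrite le_max lexx orbT.
have mono : - w x - (x - H%:R) * P x <= - w y - (x - H%:R) * P y.
  apply: (is_derive1_le (f := fun t => - w t - (x - H%:R) * P t)
    (df := fun t => - ((H%:R - t) * p t) - (x - H%:R) * p t)) => [//||].
    move=> t tb; apply: is_derive1B.
      by apply: is_derive1N; apply: is_derive_chi2_weight; lra.
    by apply: is_derive1Z; apply: dP; lra.
  move=> t tb; have : 0 < p t by apply: p_gt0; lra.
  by nra.
have wy : 0 < w y by apply: chi2_weight_gt0; lra.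
have : (x - H%:R) * (1 - P y) <= e by rewrite mulrC -ler_pdivlMr //; lra.
by move: mono; nra.
Qed.

(** The factor [e^(t/H)] makes [w e^(t/H) - P] increasing up to [H + 1], since
    [H - t + 2 t / H >= 1] there: times [H] this reads [H^2 - t (H - 2) >= H], whose worst case for
    [H >= 2] is [t = H + 1]. The sign of [H - 2] sets [H = 1] apart. *)
Lemma chi2_cdf_le_expR_weight x : 0 < x -> x <= H%:R + 1 -> P x <= expR 2 * w x.
Proof.
move=> x0 xH; apply: le_trans (_ : w x * expR (x / H%:R) <= _); last first.
  rewrite mulrC ler_pM2r ?chi2_weight_gt0 // ler_expR ler_pdivrMr ?(lt_le_trans ltr01) //.
  by have := H1; lra.
rewrite -subr_ge0; apply: ge0_of_nearly => e e0.
have [y /andP[y0 yx] Py] := P_small x0 e0.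
have mono : w y * expR (y / H%:R) - P y <= w x * expR (x / H%:R) - P x.
  apply: (is_derive1_le (f := fun t => w t * expR (t / H%:R) - P t)
    (df := fun t => (w t * (expR (t / H%:R) * H%:R^-1)
      + expR (t / H%:R) * ((H%:R - t) * p t)) - p t)) => [//||].
    move=> t tb; apply: is_derive1B; last by apply: dP; lra.
    apply: is_derive1M; first by apply: is_derive_chi2_weight; lra.
    apply: is_derive1_chain.
    apply: is_derive1_eq (is_derive1M (is_derive1_id t) (is_derive1_cst H%:R^-1 t)) _.
    by rewrite mulr0 add0r mulr1.
  have h1 := H1; move=> t tb; have pt : 0 < p t by apply: p_gt0; lra.
  have et : 1 <= expR (t / H%:R).
    by rewrite -expR0 ler_expR divr_ge0 //; lra.
  rewrite /chi2_weight -/(p t).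
  rewrite (_ : _ - p t = p t * (expR (t / H%:R) * (H%:R - t + 2 * t / H%:R) - 1)); last by field.
  rewrite mulr_ge0 ?(ltW pt) // subr_ge0.
  have h : 1 <= H%:R - t + 2 * t / H%:R.
    rewrite -(ler_pM2r (_ : 0 < H%:R)) ?mulrDl ?divfK; [|lra..].
    have [h2|h2] := leP 2 (H%:R : R); first by nra.
    have : H%:R = 1 :> R.
      have : (H < 2)%N by rewrite -(ltr_nat R).
      by case: (H) H_gt0 => [//|[|//]].
    by move=> ->; lra.
  by nra.
have : 0 <= w y * expR (y / H%:R) by rewrite mulr_ge0 ?expR_ge0 // ltW // chi2_weight_gt0.
by move: mono Py; lra.
Qed.

(** Near 0 the constant [2 / Z] of [w_sqrt_le] must be bounded in terms of [H]. Evaluating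
    [w <= H P] at 1 does it: [(2 / Z) e^(-1/2) = w 1 <= H]. *)
Lemma chi2_weight_le_sqrt x : 0 < x -> w x <= expR 1 * H%:R * Num.sqrt x.
Proof.
have h1 := H1; have e1 : 1 <= expR 1 :> R by have := expR_ge1Dx (1 : R); lra.
move=> x0; have [x1|x1] := leP 1 x.
  apply: le_trans (chi2_weight_le_cdf x0) _.
  have s1 : 1 <= Num.sqrt x by rewrite -sqrtr1 ler_wsqrtr.
  have := chi2_cdf_le1 x H_gt0; have := chi2_cdf_ge0 x H_gt0.
  have : H%:R <= expR 1 * H%:R :> R by nra.
  by nra.
apply: le_trans (w_sqrt_le x0 (ltW x1)) _.
rewrite ler_wpM2r ?sqrtr_ge0 //.
have := chi2_weight_le_cdf (@ltr01 R); have := chi2_cdf_le1 (1 : R) H_gt0.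
rewrite /w /chi2_dens ltr01 powR1 mul1r => P1 h.
have h2 : 2 / chi2_norm R H * expR (- 1 / 2) <= H%:R.
  by apply: le_trans (_ : H%:R * P 1 <= _); [move: h; lra | nra].
have -> : 2 / chi2_norm R H = (2 / chi2_norm R H * expR (- 1 / 2)) * expR (1 / 2).
  by rewrite -mulrA -expRD (_ : - 1 / 2 + 1 / 2 = 0 :> R) ?expR0 ?mulr1 //; lra.
rewrite mulrC ler_pM ?expR_ge0 //; last by rewrite ler_expR; lra.
by rewrite mulr_ge0 ?expR_ge0 // divr_ge0 // ltW.
Qed.

(** The derivative of [r |-> P (r^2)] is [w (r^2) / r]. The left end point 0, where [P] is not known
    to be differentiable, is reached as a limit. *)
Lemma chi2_cdf_sqr_lipschitz r s : 0 <= s -> s <= r ->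
  P (r ^+ 2) - P (s ^+ 2) <= expR 1 * H%:R * (r - s).
Proof.
set L := expR 1 * H%:R.
have L0 : 0 <= L by rewrite mulr_ge0 ?expR_ge0.
have pos t u : 0 < t -> t <= u -> P (u ^+ 2) - P (t ^+ 2) <= L * (u - t).
  move=> t0 tu.
  have : L * t - P (t ^+ 2) <= L * u - P (u ^+ 2); last by lra.
  apply: (is_derive1_le (f := fun v => L * v - P (v ^+ 2))
    (df := fun v => L * 1 - p (v ^+ 2) * (2 * v))) => [//||].
    move=> v vb; have v0 : 0 < v by lra.
    exact: (is_derive1B (is_derive1Z L (is_derive1_id v)) (is_derive1_chain
      (f := P) (g := fun t => t ^+ 2) (dP (exprn_gt0 2 v0)) (is_derive1_sqr v))).
  move=> v vb; have v0 : 0 < v by lra.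
  have := chi2_weight_le_sqrt (exprn_gt0 2 v0).
  rewrite sqrtr_sqr (ger0_norm (ltW v0)) /w -/(p _) -/L => h.
  by rewrite -(pmulr_rge0 _ v0); move: h; nra.
rewrite le_eqVlt => /predU1P[<-|s0 sr]; last exact: pos.
move=> r0; rewrite expr0n /= (chi2_cdf_le0 H (lexx 0)) !subr0.
rewrite le_eqVlt in r0; case/predU1P: r0 => [<-|r0].
  by rewrite expr0n /= (chi2_cdf_le0 H (lexx 0)) mulr0.
rewrite -subr_ge0; apply: ge0_of_nearly => e e0.
have [y /andP[y0 yr] Py] := P_small (exprn_gt0 2 r0) e0.
have sy : Num.sqrt y <= r by rewrite -(ger0_norm (ltW r0)) -sqrtr_sqr ler_wsqrtr.
have := pos (Num.sqrt y) r; rewrite sqrtr_gt0 (sqr_sqrtr (ltW y0)) => /(_ y0 sy).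
have := sqrtr_ge0 y; nra.
Qed.

End ChiSquareBounds.

(** * The radial Stein equation *)

Section Ramp.
Variables (R : realType) (a b : R) (a_gt0 : 0 < a) (a_lt_b : a < b) (b_le1 : b <= 1).
Implicit Types p q : R.

(* In the scale of the distribution function the target law is uniform, so
   that the mean [(a + b) / 2] of a ramp does not depend on [H]. *)
Definition ramp p : R := (Num.max 0 (b - p) - Num.max 0 (a - p)) / (b - a).
Definition ramp_mean : R := (a + b) / 2.
Definition ramp_primitive p : R :=
  ramp_mean - (Num.max 0 (b - p) ^+ 2 - Num.max 0 (a - p) ^+ 2) / (2 * (b - a)).
Local Notation m := ramp_mean.
Local Notation J p := (ramp_primitive p - m * p).

Lemma is_derive1_max0_sqr p : is_derive p 1 (fun t : R => Num.max 0 t ^+ 2) (2 * Num.max 0 p).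
Proof.
apply: (@is_derive1_of_quadratic _ _ _ _ 1) => t; rewrite mul1r.
rewrite ler_norml.
have [h1|h1] := leP 0 p; have [h2|h2] := leP 0 (t + p); rewrite ?expr0n /=; nra.
Qed.

Lemma is_derive1_ramp_primitive p : is_derive p 1 ramp_primitive (ramp p).
Proof.
have ba : b - a != 0 by rewrite gt_eqF // subr_gt0.
have d c : is_derive p 1 (fun t : R => Num.max 0 (c - t) ^+ 2) (2 * Num.max 0 (c - p) * (0 - 1)).
  exact: (is_derive1_chain (f := fun t : R => Num.max 0 t ^+ 2) (g := fun t => c - t)
    (is_derive1_max0_sqr _) (is_derive1B (is_derive1_cst c p) (is_derive1_id p))).
apply: is_derive1_eq (is_derive1B (is_derive1_cst m p) (is_derive1M (is_derive1B (d b) (d a))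
  (is_derive1_cst (2 * (b - a))^-1 p))) _.
by rewrite /ramp; field.
Qed.

Lemma ramp_lo p : p <= a -> ramp p = 1 /\ ramp_primitive p = p.
Proof.
have ab := a_lt_b; move=> pa; rewrite /ramp /ramp_primitive /m !max_r; [|lra..].
by split; field; lra.
Qed.

Lemma ramp_mid p : a <= p -> p <= b ->
  ramp p = (b - p) / (b - a) /\ ramp_primitive p = m - (b - p) ^+ 2 / (2 * (b - a)).
Proof.
have ab := a_lt_b; move=> ap pb; rewrite /ramp /ramp_primitive /m (@max_r _ _ _ (b - p)); last by lra.
by rewrite max_l; last lra; rewrite expr0n /= !subr0.
Qed.

Lemma ramp_hi p : b <= p -> ramp p = 0 /\ ramp_primitive p = m.
Proof.
have ab := a_lt_b; move=> bp; rewrite /ramp /ramp_primitive !max_l; [|lra..].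
by rewrite subrr mul0r expr0n /= subrr mul0r subr0.
Qed.

(** [J p] is the integral of [ramp - m] over [[0, p]] and, that function having mean zero, minus its
    integral over [[p, 1]]; hence the two bounds on [J]. The last inequality holds because the ramp
    vanishes beyond [b <= 2 m]. *)
Lemma ramp_bounds p : 0 <= p -> p <= 1 ->
  [/\ 0 <= ramp p <= 1, `|J p| <= p, `|J p| <= 1 - p, 0 <= ramp_primitive p <= m
    & ramp p * p <= 2 * m].
Proof.
have a0 := a_gt0; have ab := a_lt_b; have b1 := b_le1; move=> p0 p1; have hm : m = (a + b) / 2 by [].
have [pa|/ltW ap] := leP p a.
  have [-> ->] := ramp_lo pa; split; rewrite ?ler_norml; try apply/andP; try split; nra.
have [pb|/ltW bp] := leP p b; last first.
  have [-> ->] := ramp_hi bp; split; rewrite ?ler_norml; try apply/andP; try split; nra.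
have [-> ->] := ramp_mid ap pb.
have ba : 0 < b - a by lra.
set u := (b - p) / (b - a).
have u0 : 0 <= u by rewrite divr_ge0 //; lra.
have u1 : u <= 1 by rewrite ler_pdivrMr //; lra.
have -> : (b - p) ^+ 2 / (2 * (b - a)) = u * (b - p) / 2 by rewrite /u; field; lra.
set q := u * (b - p) / 2.
have q0 : 0 <= q by rewrite /q; nra.
have q1 : q <= (b - p) / 2 by rewrite /q; nra.
have hq : m - q <= p.
  rewrite -subr_ge0 (_ : p - (m - q) = (b - a) * (1 - u) ^+ 2 / 2).
    by rewrite divr_ge0 // mulr_ge0 ?sqr_ge0 // ltW.
  by rewrite /q /m /u; field; lra.
have m01 : 0 <= m <= 1 by lra.
have mp : 0 <= m * p <= p by nra.
have mp' : 0 <= m * (1 - p) <= 1 - p by nra.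
have up : u * p <= p by nra.
split; rewrite ?ler_norml; try apply/andP; try split; lra.
Qed.

Lemma ramp_lipschitz p q (d : R) : `|p - q| <= d ->
  `|ramp p - ramp q| <= d / (b - a) * ((a - d <= q) && (q <= b + d))%:R.
Proof.
have ab := a_lt_b; move=> pq; have ba : 0 < b - a by lra.
have d0 : 0 <= d by apply: le_trans pq.
move: (pq); rewrite ler_norml => /andP[h1 h2].
have [hl|hl] := leP (a - d) q; last first.
  have [pa qa] : p <= a /\ q <= a by split; lra.
  by rewrite (ramp_lo pa).1 (ramp_lo qa).1 subrr normr0 mulr0.
have [hr|hr] := leP q (b + d); last first.
  have [pa qa] : b <= p /\ b <= q by split; lra.
  by rewrite (ramp_hi pa).1 (ramp_hi qa).1 subrr normr0 mulr0.
rewrite mulr1 /ramp -mulrBl normrM [`|_^-1|]ger0_norm ?invr_ge0 ?(ltW ba) //.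
rewrite ler_wpM2r ?invr_ge0 ?(ltW ba) // ler_norml.
have [k1|k1] := leP 0 (b - p); have [k2|k2] := leP 0 (a - p);
have [k3|k3] := leP 0 (b - q); have [k4|k4] := leP 0 (a - q); lra.
Qed.

End Ramp.

(** * Size and continuity of the Stein solution for a ramp *)

Section SteinSolution.
Variables (R : realType) (H : nat) (H_gt0 : (0 < H)%N).
Variables (a b : R) (a_gt0 : 0 < a) (a_lt_b : a < b) (b_le1 : b <= 1).
Implicit Types (x r : R).
Local Notation P := (@chi2_cdf R H).
Local Notation w := (chi2_weight H).
Local Notation m := (ramp_mean a b).

(* On [x <= 0] the value is the limit at [0+], which makes [stein_sol]
   continuous; [stein_dev x] is then [2 * x * stein_sol' x] for [0 < x]. *)
Definition stein_sol x : R :=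
  if 0 < x then (ramp_primitive a b (P x) - m * P x) / w x else (1 - m) / H%:R.
Definition stein_dev x : R := ramp a b (P x) - m - (H%:R - x) * stein_sol x.
Local Notation psi := stein_sol.
Local Notation theta := stein_dev.

Let H1 : 1 <= H%:R :> R. Proof. by rewrite ler1n. Qed.
Let P01 x : 0 <= P x /\ P x <= 1.
Proof. by split; [exact: chi2_cdf_ge0 | exact: chi2_cdf_le1]. Qed.

Lemma is_derive1_stein_sol x : 0 < x -> is_derive x 1 psi (theta x / (2 * x)).
Proof.
move=> x0; have w0 := chi2_weight_gt0 H_gt0 x0.
have wn0 : w x != 0 by rewrite gt_eqF.
have dP := is_derive_chi2_cdf H_gt0 x0.
have dJ := is_derive1B (is_derive1_chain (g := P) (is_derive1_ramp_primitive a_lt_b (P x)) dP)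
  (is_derive1Z m dP).
have dq := is_derive1M dJ (is_derive1V wn0 (is_derive_chi2_weight H_gt0 x0)).
have d1 : is_derive x 1 (fun t => (ramp_primitive a b (P t) - m * P t) / w t) (theta x / (2 * x)).
  apply: is_derive1_eq dq _.
  rewrite /theta /psi x0.
  have : chi2_dens H x / chi2_norm R H = w x / (2 * x) by rewrite /w; field; rewrite !gt_eqF ?chi2_norm_gt0.
  move=> ->; field; by rewrite wn0 gt_eqF.
apply: near_eq_is_derive d1; near=> t; rewrite /psi.
suff -> : 0 < t by [].
by near: t; exact: lt_nbhsr.
Unshelve. all: by end_near. Qed.

(** Below [H] the numerator is bounded by [P], above [H] by [1 - P]; each has its own comparison
    with the weight. *)
Lemma stein_dev_le2 x : 0 < x -> `|(H%:R - x) * psi x| <= 1 /\ `|theta x| <= 2.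
Proof.
have a0 := a_gt0; have ab := a_lt_b; have b1 := b_le1; move=> x0; have w0 := chi2_weight_gt0 H_gt0 x0.
have [P0 P1] := P01 x.
have [/andP[r0 r1] J1 J2 _ _] := ramp_bounds a_gt0 a_lt_b b_le1 P0 P1.
have m01 : 0 < m < 1 by rewrite /m; lra.
have h : `|(H%:R - x) * psi x| <= 1.
  rewrite /psi x0 mulrA normrM [`|_^-1|]ger0_norm ?invr_ge0 ?(ltW w0) //.
  rewrite ler_pdivrMr // mul1r normrM.
  have [xH|xH] := leP x H%:R.
    rewrite ger0_norm ?subr_ge0 //; apply: le_trans (chi2_cdf_le_weight H_gt0 x0).
    by rewrite ler_wpM2l // subr_ge0.
  have -> : `|H%:R - x| = x - H%:R by rewrite ltr0_norm ?subr_lt0 // opprB.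
  apply: le_trans (chi2_tail_le_weight H_gt0 x0).
  by rewrite ler_wpM2l // subr_ge0 ltW.
split=> //; rewrite /theta; apply: le_trans (ler_normB _ _) _.
apply: lerD => //; rewrite ler_norml; lra.
Qed.

(** The cases split at [H + 1], beyond which the factor [x - H] of the tail inequality is at least
    1. *)
Lemma stein_sol_bound x : 0 < x -> `|psi x| <= expR 2.
Proof.
have a0 := a_gt0; have ab := a_lt_b; have b1 := b_le1; move=> x0; have w0 := chi2_weight_gt0 H_gt0 x0.
have [P0 P1] := P01 x.
have [_ J1 J2 _ _] := ramp_bounds a_gt0 a_lt_b b_le1 P0 P1.
rewrite /psi x0 normrM [`|_^-1|]ger0_norm ?invr_ge0 ?(ltW w0) // ler_pdivrMr //.
have [xH|xH] := leP x (H%:R + 1).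
  exact: le_trans J1 (chi2_cdf_le_expR_weight H_gt0 x0 xH).
have := chi2_tail_le_weight H_gt0 x0; have := expR_ge1Dx (2 : R).
move: J2; move: `|_| => j; nra.
Qed.

(** The decay in [sqrt x] will pay for a division by the radius. It comes from [A = P / w], for
    which [1 / H <= A] and [(H - x) A <= 1], so that [1 - (H - x) A] lies between 0 and [x / H].
    While [P x <= a], [theta] is exactly [1 - m] times this. *)
Lemma stein_dev_small x : 0 < x -> x <= H%:R ->
  `|theta x| <= 2 * Num.sqrt x + 2 * m / P x * (a < P x)%R%:R.
Proof.
have a0 := a_gt0; have ab := a_lt_b; have b1 := b_le1; move=> x0 xH; have w0 := chi2_weight_gt0 H_gt0 x0.
have [P0 P1] := P01 x; have Pgt0 := chi2_cdf_gt0 H_gt0 x0.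
have [/andP[r0 r1] J1 J2 /andP[g0 gm] rp] := ramp_bounds a_gt0 a_lt_b b_le1 P0 P1.
have m01 : 0 < m < 1 by rewrite /m; lra.
pose A := P x / w x.
have A1 : (H%:R - x) * A <= 1.
  by rewrite /A mulrA ler_pdivrMr // mul1r chi2_cdf_le_weight.
have A2 : 1 <= H%:R * A by rewrite /A mulrA ler_pdivlMr // mul1r chi2_weight_le_cdf.
have A0 : 0 < A by rewrite divr_gt0.
have h1 := H1.
have s0 : 0 < Num.sqrt x by rewrite sqrtr_gt0.
have s2 : Num.sqrt x ^+ 2 = x by rewrite sqr_sqrtr // ltW.
set s := Num.sqrt x in s0 s2 *.
have sH : s <= H%:R by nra.
have dA : 0 <= 1 - (H%:R - x) * A <= s.
  rewrite subr_ge0 A1 /= -(ler_pM2l (lt_le_trans ltr01 h1)).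
  have : (H%:R - x) * (H%:R * A - 1) >= 0 by rewrite mulr_ge0 // subr_ge0.
  nra.
have E : theta x = (ramp a b (P x) - (H%:R - x) * (ramp_primitive a b (P x) / w x))
    - m * (1 - (H%:R - x) * A).
  by rewrite /theta /psi x0 /A; field; rewrite gt_eqF.
have [Pa|Pa] := leP (P x) a.
  rewrite mulr0 addr0 E; have [-> ->] := ramp_lo a_lt_b Pa; rewrite -/A ler_norml.
  by apply/andP; split; nra.
rewrite mulr1 E.
set B := (H%:R - x) * _.
have B0 : 0 <= B by rewrite /B mulr_ge0 ?subr_ge0 // divr_ge0 // ltW.
have BP : B <= m / P x.
  rewrite ler_pdivlMr // (_ : B * P x = (H%:R - x) * A * ramp_primitive a b (P x)); last first.
    by rewrite /B /A; field; rewrite gt_eqF.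
  apply: le_trans gm; rewrite -[leRHS]mul1r ler_wpM2r //.
have rP : ramp a b (P x) <= 2 * m / P x by rewrite ler_pdivlMr.
rewrite -mulrA; move: rP BP; rewrite -mulrA; set z := m / P x => rP BP.
rewrite ler_norml; apply/andP; split; nra.
Qed.

Lemma continuous_stein_sol : continuous psi.
Proof.
move=> x; have [x0|x0|->] := ltgtP x 0.
- apply: (@near_cst_continuous _ _ ((1 - m) / H%:R)).
  near=> t; rewrite /psi ifF //; apply/negbTE; rewrite -leNgt ltW //.
  by near: t; exact: lt_nbhsl.
- exact: is_derive1_continuous (is_derive1_stein_sol x0).
have h1 := H1; have a0 := a_gt0; have ab := a_lt_b; have b1 := b_le1.
have m01 : 0 < m < 1 by rewrite /m; lra.
(* Below [d] the ramp equals 1 and [psi] is [(1 - m) P / w], which is squeezed between multiples of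
   [1 / H] and [1 / (H - t)]. *)
have [d d0 Pd] := chi2_cdf_near0 H_gt0 a_gt0.
apply/cvgrPdist_le => /= e e0.
have c0 : 0 < Num.min (Num.min d 2^-1) (e / 2) by rewrite !lt_min d0 /= invr_gt0 ltr0n /= divr_gt0.
have : \forall t \near (0 : R), `|t| < Num.min (Num.min d 2^-1) (e / 2) by exact: nbhs0_lt.
apply: filterS => t; rewrite !lt_min => /andP[/andP[td t2] te].
rewrite [psi 0]/psi ltxx /psi; case: ifP => [t0|]; last by rewrite subrr normr0 ltW.
rewrite gtr0_norm // in td t2 te.
have Pa : P t <= a by apply: le_trans (ltW Pd); apply: le_chi2_cdf => //; exact: ltW.
rewrite (ramp_lo a_lt_b Pa).2.
have w0 := chi2_weight_gt0 H_gt0 t0.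
pose A := P t / w t.
have A1 : (H%:R - t) * A <= 1.
  by rewrite /A mulrA ler_pdivrMr // mul1r chi2_cdf_le_weight.
have A2 : H%:R^-1 <= A.
  rewrite -[_^-1]mul1r ler_pdivrMr ?(lt_le_trans ltr01) // mulrC /A mulrA ler_pdivlMr //.
  by rewrite mul1r chi2_weight_le_cdf.
have -> : (1 - m) / H%:R - (P t - m * P t) / w t = (1 - m) * (H%:R^-1 - A).
  by rewrite /A; ring.
have i0 : 0 < H%:R^-1 :> R by rewrite invr_gt0 (lt_le_trans ltr01).
have iH : H%:R * H%:R^-1 = 1 :> R by rewrite divff // gt_eqF // (lt_le_trans ltr01).
move: A1 A2; move: (A) (H%:R^-1 : R) i0 iH => z i i0 iH A1 A2.
have z2 : z <= 2 by nra.
have zi : z - i <= 2 * t by nra.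
rewrite ler_norml; apply/andP; split; nra.
Unshelve. all: by end_near. Qed.

End SteinSolution.

(** * Mean value inequalities *)

Section MeanValueBounds.
Variable R : realType.
Implicit Types (f df : R -> R) (x y c M : R).

Lemma MVT_le f df x y c M : x <= y -> continuous f ->
  (forall t, x < t < y -> is_derive t 1 f (df t) /\ `|df t - c| <= M) ->
  `|f y - f x - c * (y - x)| <= M * (y - x).
Proof.
rewrite le_eqVlt => /predU1P[-> _ _|xy cf fd]; first by rewrite !subrr !mulr0 subr0 normr0.
have [t||t] := MVT (f := f) (df := df) xy.
- by rewrite in_itv /= => /fd[].
- exact: continuous_subspaceT.
rewrite in_itv /= => /fd[_ h] ->; rewrite -mulrBl normrM (ger0_norm (_ : 0 <= y - x)); last first.
  by rewrite subr_ge0 ltW.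
by rewrite ler_wpM2r // subr_ge0 ltW.
Qed.

Lemma MVT_le_norm f df x y M : continuous f ->
  (forall t, Num.min x y < t < Num.max x y -> is_derive t 1 f (df t) /\ `|df t| <= M) ->
  `|f y - f x| <= M * `|y - x|.
Proof.
move=> cf fd.
have key u v : u <= v -> Num.min u v = Num.min x y -> Num.max u v = Num.max x y ->
    `|f v - f u| <= M * (v - u).
  move=> uv e1 e2; have := @MVT_le f df u v 0 M uv cf.
  rewrite mul0r subr0; apply=> t tuv; rewrite subr0; apply: fd.
  by rewrite -e1 -e2 min_l // max_r.
have [xy|/ltW yx] := leP x y.
  by rewrite (ger0_norm (_ : 0 <= y - x)) ?subr_ge0 //; exact: key.
rewrite distrC (distrC y) (ger0_norm (_ : 0 <= x - y)) ?subr_ge0 //.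
by apply: key => //; [rewrite minC | rewrite maxC].
Qed.

(** A segment in the vector space may pass through the origin, where [psi] need not be
    differentiable; this can happen for one parameter at most. *)
Lemma MVT_le_except f df (s0 : R) c M : continuous f ->
  (forall t, 0 < t < 1 -> t != s0 -> is_derive t 1 f (df t) /\ `|df t - c| <= M) ->
  `|f 1 - f 0 - c| <= M.
Proof.
move=> cf fd.
have [/andP[s1 s2]|ns] := boolP (0 < s0 < 1); last first.
  have := @MVT_le f df 0 1 c M ler01 cf; rewrite subr0 !mulr1; apply=> t t01.
  by apply: fd => //; apply/eqP => ts; move: ns; rewrite -ts t01.
have h1 : `|f s0 - f 0 - c * (s0 - 0)| <= M * (s0 - 0).
  apply: (MVT_le (df := df)) => //; first exact: ltW.
  by move=> t tb; apply: fd; [lra | rewrite lt_eqF //; lra].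
have h2 : `|f 1 - f s0 - c * (1 - s0)| <= M * (1 - s0).
  apply: (MVT_le (df := df)) => //; first exact: ltW.
  by move=> t tb; apply: fd; [lra | rewrite gt_eqF //; lra].
rewrite (_ : f 1 - f 0 - c = (f s0 - f 0 - c * (s0 - 0)) + (f 1 - f s0 - c * (1 - s0))); last by ring.
apply: le_trans (ler_normD _ _) _; lra.
Qed.

End MeanValueBounds.

(** * Variation of the Stein solution with the radius *)

Section SteinVariation.
Variables (R : realType) (H : nat) (H_gt0 : (0 < H)%N).
Variables (a b : R) (a_gt0 : 0 < a) (a_lt_b : a < b) (b_le1 : b <= 1).
Implicit Types (x r : R).
Local Notation P := (@chi2_cdf R H).
Local Notation m := (ramp_mean a b).
Local Notation psi := (stein_sol H a b).
Local Notation theta := (stein_dev H a b).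
Local Notation L := (expR 1 * H%:R : R).

Definition stein_slope r : R :=
  12 * H%:R + (12 + 2 * expR 2) * (r + 1)
  + 27 * expR 1 * H%:R ^+ 2 * (m / P (r ^+ 2) ^+ 2 * (a / 2 < P (r ^+ 2))%R%:R).

Let H1 : 1 <= H%:R :> R. Proof. by rewrite ler1n. Qed.

(** [theta (r ^+ 2) / r] is the derivative of [psi (r ^+ 2)] in [r]. Its coefficient [5 + |H - r^2|]
    covers its contributions to the variation of [psi], of [(H - x) psi] and of the angular term.
    For [x <= H], the estimate [P x <= e H r] trades the division by [r] for another factor [1 / P];
    for [x > H], [|theta| <= 2] suffices. *)
Lemma stein_slope_local r : 0 < r ->
  (5 + `|H%:R - r ^+ 2|) * (`|theta (r ^+ 2)| / r) + 2 * r * `|psi (r ^+ 2)|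
  <= 12 * H%:R + (12 + 2 * expR 2) * r
     + 12 * expR 1 * H%:R ^+ 2 * (m / P (r ^+ 2) ^+ 2 * (a < P (r ^+ 2))%R%:R).
Proof.
move=> r0; have h1 := H1; have a0 := a_gt0; have ab := a_lt_b; have b1 := b_le1.
have m01 : 0 < m < 1 by rewrite /ramp_mean; lra.
set x := r ^+ 2; have x0 : 0 < x by rewrite exprn_gt0.
have pb := stein_sol_bound H_gt0 a_gt0 a_lt_b b_le1 x0.
have [_ t2] := stein_dev_le2 H_gt0 a_gt0 a_lt_b b_le1 x0.
have Pgt0 := chi2_cdf_gt0 H_gt0 x0.
have e1 := expR_gt0 (1 : R).
have h2 : 2 * r * `|psi x| <= 2 * expR 2 * r.
  by rewrite mulrAC ler_wpM2r ?(ltW r0) // ler_pM2l.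
set G := m / P x ^+ 2 * _.
have G0 : 0 <= G by rewrite /G !mulr_ge0 ?invr_ge0 ?exprn_ge0 //; lra.
have [xH|xH] := leP x H%:R; last first.
  have h3 : (5 + `|H%:R - x|) * (`|theta x| / r) <= 12 * r.
    rewrite mulrA ler_pdivrMr // ltr0_norm ?subr_lt0 //.
    have : 0 <= `|theta x| by [].
    by rewrite -mulrA -expr2 -/x; nra.
  have : 0 <= 12 * expR 1 * H%:R ^+ 2 * G.
    by apply: mulr_ge0 => //; rewrite !mulr_ge0 ?exprn_ge0 ?(ltW e1).
  by nra.
have td := stein_dev_small H_gt0 a_gt0 a_lt_b b_le1 x0 xH.
rewrite sqrtr_sqr (ger0_norm (ltW r0)) in td.
have PL : P x <= L * r.
  have := chi2_cdf_sqr_lipschitz H_gt0 (lexx 0) (ltW r0).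
  by rewrite expr0n /= (chi2_cdf_le0 H (lexx 0)) !subr0.
have h3 : `|theta x| / r <= 2 + 2 * L * G.
  rewrite ler_pdivrMr //; apply: le_trans td _; rewrite [leRHS]mulrDl lerD2l /G.
  rewrite (_ : 2 * L * _ * r = 2 * (m / P x) * (a < P x)%R%:R * (L * r / P x)); last first.
    by field; rewrite gt_eqF.
  rewrite -(mulrA 2 m) -[leLHS]mulr1 ler_wpM2l //.
    by rewrite !mulr_ge0 ?invr_ge0 //; lra.
  by rewrite ler_pdivlMr // mul1r.
have h4 : (5 + `|H%:R - x|) * (`|theta x| / r) <= 6 * H%:R * (2 + 2 * L * G).
  apply: ler_pM => //; first by rewrite divr_ge0 // ltW.
  by rewrite ger0_norm ?subr_ge0 //; lra.
have := expR_gt0 (2 : R).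
rewrite (_ : 6 * H%:R * (2 + 2 * L * G) = 12 * H%:R + 12 * expR 1 * H%:R ^+ 2 * G) in h4; last by ring.
by nra.
Qed.

Lemma chi2_cdf_sqr_close r s (h : R) : 0 <= r -> 0 <= s -> `|s - r| <= h ->
  `|P (s ^+ 2) - P (r ^+ 2)| <= L * h.
Proof.
move=> r0 s0 rs.
have L0 : 0 <= L by rewrite mulr_ge0 ?expR_ge0.
apply: le_trans (_ : L * `|s - r| <= _); last by rewrite ler_wpM2l.
have [rs'|/ltW sr] := leP r s.
  rewrite !ger0_norm ?subr_ge0 //; first exact: chi2_cdf_sqr_lipschitz.
  by apply: le_chi2_cdf => //; rewrite ler_sqr ?nnegrE.
rewrite distrC (distrC s) !ger0_norm ?subr_ge0 //; first exact: chi2_cdf_sqr_lipschitz.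
by apply: le_chi2_cdf => //; rewrite ler_sqr ?nnegrE.
Qed.

(** As [P] moves by at most [a / 2], a value [p > a] at [s] forces [q > a / 2] and [q <= 3 p / 2] at
    [r]; the square of 3/2 turns the constant 12 into 27. The displacement of the radius is absorbed
    by [r + 1]. *)
Lemma stein_slope_near r s (h : R) : 0 < s -> 0 <= r -> `|s - r| <= h -> h <= 1 ->
  L * h <= a / 2 ->
  (5 + `|H%:R - s ^+ 2|) * (`|theta (s ^+ 2)| / s) + 2 * s * `|psi (s ^+ 2)| <= stein_slope r.
Proof.
move=> s0 r0 sr h1 Lh; apply: le_trans (stein_slope_local s0) _.
have a0 := a_gt0; have ab := a_lt_b; have b1 := b_le1.
have m01 : 0 < m < 1 by rewrite /ramp_mean; lra.
have := chi2_cdf_sqr_close r0 (ltW s0) sr; rewrite /stein_slope.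
have := chi2_cdf_gt0 H_gt0 (exprn_gt0 2 s0); have := chi2_cdf_ge0 (r ^+ 2) H_gt0.
move: (P (s ^+ 2)) (P (r ^+ 2)) => p q q0 p0; rewrite ler_norml => /andP[pq1 pq2].
have E1 := expR_gt0 (1 : R); have E2 := expR_gt0 (2 : R).
have H0 : 0 <= H%:R :> R by [].
move: sr; rewrite ler_norml => /andP[sr1 sr2].
apply: lerD.
  by rewrite lerD2l ler_wpM2l //; lra.
have [pa|pa] := leP p a.
  by rewrite !mulr0 !mulr_ge0 ?invr_ge0 ?exprn_ge0 ?(ltW E1) //; lra.
have qa : a / 2 < q by lra.
rewrite qa !mulr1.
rewrite (_ : 27 * expR 1 * _ * _ = 12 * expR 1 * H%:R ^+ 2 * (9 / 4 * (m / q ^+ 2))); last by field; lra.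
rewrite ler_wpM2l ?mulr_ge0 ?exprn_ge0 ?(ltW E1) //.
rewrite ler_pdivrMr ?exprn_gt0 //.
rewrite (_ : 9 / 4 * (m / q ^+ 2) * p ^+ 2 = m * (3 * p / (2 * q)) ^+ 2); last by field; lra.
rewrite -[leLHS]mulr1 ler_wpM2l //; first lra.
by apply: exprn_ege1; rewrite ler_pdivlMr; lra.
Qed.

Lemma stein_slope_ge0 r : 0 <= r -> 0 <= stein_slope r.
Proof.
move=> r0; have a0 := a_gt0; have ab := a_lt_b; have b1 := b_le1.
have m01 : 0 < m < 1 by rewrite /ramp_mean; lra.
have := chi2_cdf_ge0 (r ^+ 2) H_gt0.
have E1 := expR_gt0 (1 : R); have E2 := expR_gt0 (2 : R).
by move=> p0; rewrite /stein_slope !addr_ge0 ?mulr_ge0 ?invr_ge0 ?exprn_ge0 //; lra.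
Qed.

Let cont_sqr : continuous (fun t : R => t ^+ 2).
Proof. by move=> t; apply: is_derive1_continuous (is_derive1_sqr t). Qed.

(** By definition [theta] varies like the ramp, up to the variation of [(H - x) psi]. The latter,
    the variation of [psi] and the angular term cost [h * stein_slope] each; the indicator comes
    from the ramp alone. *)
Lemma stein_variation r s (h : R) : 0 <= s -> 0 <= r -> `|s - r| <= h -> h <= 1 ->
  L * h <= a / 2 ->
  `|psi (s ^+ 2) - psi (r ^+ 2)| + `|theta (s ^+ 2) - theta (r ^+ 2)|
    + 4 * h * (`|theta (r ^+ 2)| / r)
  <= 3 * h * stein_slope r
     + L * h / (b - a) * ((a - L * h <= P (r ^+ 2)) && (P (r ^+ 2) <= b + L * h))%R%:R.
Proof.
move=> s0 r0 sr h1 Lh.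
have h0 : 0 <= h by apply: le_trans sr.
have c1 : continuous (fun t : R => psi (t ^+ 2)).
  move=> t; apply: (@continuous_comp _ _ _ (fun t : R => t ^+ 2) psi); first exact: cont_sqr.
  exact: (continuous_stein_sol H_gt0 a_gt0 a_lt_b b_le1).
have d1 (t : R) : 0 < t -> is_derive t 1 (fun t : R => psi (t ^+ 2)) (theta (t ^+ 2) / t).
  move=> t0; apply: is_derive1_eq (is_derive1_chain (f := psi) (g := fun t => t ^+ 2)
    (is_derive1_stein_sol H_gt0 a_lt_b (exprn_gt0 2 t0)) (is_derive1_sqr t)) _.
  by field; rewrite gt_eqF.
have between (t : R) : Num.min r s < t < Num.max r s -> 0 < t /\ `|t - r| <= h.
  rewrite gt_min lt_max => tb; split.
    by case/andP: tb => /orP[?|?] _; lra.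
  move: sr; rewrite !ler_norml; case/andP: tb => /orP[?|?] /orP[?|?]; lra.
have slope (t : R) : Num.min r s < t < Num.max r s ->
    [/\ 0 < t, `|theta (t ^+ 2)| / t <= stein_slope r &
     `|H%:R - t ^+ 2| * (`|theta (t ^+ 2)| / t) + 2 * t * `|psi (t ^+ 2)| <= stein_slope r].
  move=> /between[t0 tr]; have := stein_slope_near t0 r0 tr h1 Lh.
  have : 0 <= `|theta (t ^+ 2)| / t by rewrite divr_ge0 // ltW.
  have : 0 <= 2 * t * `|psi (t ^+ 2)| by rewrite !mulr_ge0 // ltW.
  have : 0 <= `|H%:R - t ^+ 2| by [].
  move: (_ / t) (2 * t * _) `|_| => A B C ? ? ? ?; split => //; nra.
have S0 := stein_slope_ge0 r0.
have k1 : `|psi (s ^+ 2) - psi (r ^+ 2)| <= h * stein_slope r.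
  apply: le_trans (_ : stein_slope r * `|s - r| <= _); last first.
    by rewrite mulrC ler_wpM2r.
  apply: (MVT_le_norm (f := fun t => psi (t ^+ 2))
    (df := fun t => theta (t ^+ 2) / t)) => // t /slope[t0 st _].
  split; first exact: d1.
  by rewrite normrM normfV (gtr0_norm t0).
have k2 : `|(H%:R - s ^+ 2) * psi (s ^+ 2) - (H%:R - r ^+ 2) * psi (r ^+ 2)| <= h * stein_slope r.
  apply: le_trans (_ : stein_slope r * `|s - r| <= _); last first.
    by rewrite mulrC ler_wpM2r.
  have d2 (t : R) : is_derive t 1 (fun t : R => H%:R - t ^+ 2) (0 - 2 * t).
    exact: is_derive1B (is_derive1_cst _ _) (is_derive1_sqr t).
  apply: (MVT_le_norm (f := fun t => (H%:R - t ^+ 2) * psi (t ^+ 2))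
    (df := fun t => (H%:R - t ^+ 2) * (theta (t ^+ 2) / t) + psi (t ^+ 2) * (0 - 2 * t))).
    move=> t; apply: (@continuousM R R (fun t => H%:R - t ^+ 2) (fun t => psi (t ^+ 2))); last exact: c1.
    exact: is_derive1_continuous (d2 t).
  move=> t /slope[t0 _ st]; split; first exact: is_derive1M (d2 t) (d1 t t0).
  apply: le_trans (ler_normD _ _) _; apply: le_trans st.
  rewrite !normrM normfV sub0r normrN normrM (gtr0_norm t0) (@ger0_norm _ 2) //.
  by rewrite lerD2l mulrC.
have k3 := ramp_lipschitz a_lt_b (chi2_cdf_sqr_close r0 s0 sr).
have k4 : 4 * h * (`|theta (r ^+ 2)| / r) <= h * stein_slope r.
  rewrite [4 * h]mulrC -mulrA ler_wpM2l //.
  move: r0; rewrite le_eqVlt => /predU1P[<-|r0].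
    by rewrite invr0 !mulr0 stein_slope_ge0.
  have := stein_slope_near r0 (ltW r0) _ h1 Lh; rewrite subrr normr0 => /(_ h0).
  have : 0 <= `|theta (r ^+ 2)| / r by rewrite divr_ge0 // ltW.
  have : 0 <= 2 * r * `|psi (r ^+ 2)| by rewrite !mulr_ge0 // ltW.
  have : 0 <= `|H%:R - r ^+ 2| by [].
  move: (_ / r) (2 * r * _) `|_| => A B C ? ? ? ?; nra.
have k5 : `|theta (s ^+ 2) - theta (r ^+ 2)| <= h * stein_slope r
     + L * h / (b - a) * ((a - L * h <= P (r ^+ 2)) && (P (r ^+ 2) <= b + L * h))%R%:R.
  rewrite [leRHS]addrC; apply: le_trans (lerD k3 k2); apply: le_trans (ler_normB _ _).
  by rewrite /stein_dev le_eqVlt; apply/orP; left; apply/eqP; congr `|_|; ring.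
by move: k1 k4 k5; lra.
Qed.

End SteinVariation.

(** * Increments of the Stein solution along a vector *)

Definition inner_product (R : numDomainType) (V : lmodType R) (dot : V -> V -> R) :=
  [/\ forall u v, dot u v = dot v u,
      forall u v w, dot (u + v) w = dot u w + dot v w,
      forall k u v, dot (k *: u) v = k * dot u v
    & forall u, 0 <= dot u u].

Section InnerProduct.
Variables (R : rcfType) (V : lmodType R) (dot : V -> V -> R) (ip : inner_product dot).
Implicit Types (u v w : V) (k : R).

Lemma dotC u v : dot u v = dot v u. Proof. by case: ip. Qed.
Lemma dotDl u v w : dot (u + v) w = dot u w + dot v w. Proof. by case: ip. Qed.
Lemma dotZl k u v : dot (k *: u) v = k * dot u v. Proof. by case: ip. Qed.
Lemma dot_ge0 u : 0 <= dot u u. Proof. by case: ip. Qed.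
Lemma dotDr u v w : dot w (u + v) = dot w u + dot w v.
Proof. by rewrite dotC dotDl !(dotC w). Qed.
Lemma dotZr k u v : dot v (k *: u) = k * dot v u.
Proof. by rewrite dotC dotZl (dotC v). Qed.
Lemma dotNl u v : dot (- u) v = - dot u v.
Proof. by rewrite -scaleN1r dotZl mulN1r. Qed.
Lemma dotNr u v : dot v (- u) = - dot v u.
Proof. by rewrite dotC dotNl (dotC v). Qed.
Lemma dotBl u v w : dot (u - v) w = dot u w - dot v w.
Proof. by rewrite dotDl dotNl. Qed.
Lemma dotBr u v w : dot w (u - v) = dot w u - dot w v.
Proof. by rewrite dotDr dotNr. Qed.
Lemma dot0l u : dot 0 u = 0.
Proof. by rewrite -(scale0r u) dotZl mul0r. Qed.
Lemma dot_suml (I : Type) (r : seq I) (F : I -> V) v :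
  dot (\sum_(i <- r) F i) v = \sum_(i <- r) dot (F i) v.
Proof. by elim/big_rec2: _ => [|i x y _ <-]; rewrite ?dot0l ?dotDl. Qed.
Lemma cauchy_schwarz u v : dot u v ^+ 2 <= dot u u * dot v v.
Proof.
have := dot_ge0 (dot v v *: u - dot u v *: v).
rewrite dotBl !dotBr !dotZl !dotZr (dotC v u).
have := dot_ge0 v; rewrite le_eqVlt => /predU1P[v0|v0].
  move=> _; rewrite -v0 mulr0; have [->|d0] := eqVneq (dot u v) 0; first by rewrite expr0n.
  have := dot_ge0 (u - ((dot u u + 1) / dot u v) *: v).
  rewrite dotBl !dotBr !dotZl !dotZr (dotC v u) -v0 !mulr0 subr0 divfK //.
  by have := dot_ge0 u; lra.
move=> h; rewrite -subr_ge0 -(pmulr_rge0 _ v0); move: h; lra.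
Qed.

Definition nrm u : R := Num.sqrt (dot u u).

Lemma nrm_ge0 u : 0 <= nrm u. Proof. exact: sqrtr_ge0. Qed.
Lemma nrm_sqr u : nrm u ^+ 2 = dot u u. Proof. by rewrite sqr_sqrtr ?dot_ge0. Qed.
Lemma nrmN u : nrm (- u) = nrm u. Proof. by rewrite /nrm dotNl dotNr opprK. Qed.
Lemma nrmB u v : nrm (u - v) = nrm (v - u). Proof. by rewrite -nrmN opprB. Qed.
Lemma nrmZ k u : nrm (k *: u) = `|k| * nrm u.
Proof. by rewrite /nrm dotZl dotZr mulrA -expr2 sqrtrM ?sqr_ge0 // sqrtr_sqr. Qed.

Lemma norm_dot_le u v : `|dot u v| <= nrm u * nrm v.
Proof.
by rewrite -sqrtr_sqr -sqrtrM ?dot_ge0 // ler_wsqrtr // cauchy_schwarz.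
Qed.

Lemma nrmD u v : nrm (u + v) <= nrm u + nrm v.
Proof.
rewrite -ler_sqr ?nnegrE ?addr_ge0 ?nrm_ge0 // sqrrD !nrm_sqr dotDl !dotDr (dotC v u).
have := ler_norm (dot u v); have := norm_dot_le u v; lra.
Qed.

Lemma nrm_dist u v : `|nrm u - nrm v| <= nrm (u - v).
Proof.
have h1 := nrmD (u - v) v; have h2 := nrmD (v - u) u.
rewrite !subrK (nrmB v u) in h1 h2.
by rewrite ler_norml; apply/andP; split; lra.
Qed.

(** The quotients depend only on the directions of [u] and [v], which differ by at most
    [2 h / |v|]. *)
Lemma angle_le u v D (h : R) : nrm (u - v) <= h -> 0 < dot v v ->
  `|dot D u ^+ 2 / dot u u - dot D v ^+ 2 / dot v v| <= dot D D * (4 * h / nrm v).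
Proof.
move=> uv v0; have r0 : 0 < nrm v by rewrite sqrtr_gt0.
have h0 : 0 <= h := le_trans (nrm_ge0 _) uv.
have D0 := dot_ge0 D.
have nd : `|nrm u - nrm v| <= h := le_trans (nrm_dist u v) uv.
have Y : 0 <= dot D v ^+ 2 / dot v v <= dot D D.
  rewrite divr_ge0 ?sqr_ge0 ?(ltW v0) //= ler_pdivrMr //; exact: cauchy_schwarz.
(* If [|u| = 0] its quotient is 0 by convention; then [|v| <= h], and the right-hand side exceeds
   the trivial bound [|D|^2]. *)
have := dot_ge0 u; rewrite le_eqVlt => /predU1P[u0|u0].
  rewrite -u0 invr0 mulr0 sub0r normrN ger0_norm; last by case/andP: Y.
  have rh : nrm v <= h by move: nd; rewrite {1}/nrm -u0 sqrtr0 sub0r normrN ger0_norm ?nrm_ge0.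
  have : 1 <= 4 * h / nrm v by rewrite ler_pdivlMr //; lra.
  by case/andP: Y => _ Y k; nra.
have s0 : 0 < nrm u by rewrite sqrtr_gt0.
pose p := dot D u / nrm u; pose q := dot D v / nrm v.
have -> : dot D u ^+ 2 / dot u u - dot D v ^+ 2 / dot v v = (p - q) * (p + q).
  by rewrite /p /q -!nrm_sqr; field; rewrite !gt_eqF.
have pD : `|p| <= nrm D by rewrite /p normrM normfV (gtr0_norm s0) ler_pdivrMr // norm_dot_le.
have qD : `|q| <= nrm D by rewrite /q normrM normfV (gtr0_norm r0) ler_pdivrMr // norm_dot_le.
have pq : `|p - q| <= nrm D * (2 * h / nrm v).
  have -> : p - q = (dot D (u - v) + p * (nrm v - nrm u)) / nrm v.
    by rewrite /p /q dotBr; field; rewrite !gt_eqF.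
  rewrite normrM normfV (gtr0_norm r0) mulrA ler_pM2r ?invr_gt0 //.
  apply: le_trans (ler_normD _ _) _; rewrite normrM [`|nrm v - _|]distrC.
  have : `|dot D (u - v)| <= nrm D * h.
    by apply: le_trans (norm_dot_le _ _) _; rewrite ler_wpM2l ?nrm_ge0.
  have : `|p| * `|nrm u - nrm v| <= nrm D * h by apply: ler_pM.
  by lra.
rewrite normrM -nrm_sqr.
apply: le_trans (_ : nrm D * (2 * h / nrm v) * (nrm D + nrm D) <= _); last first.
  by rewrite le_eqVlt; apply/orP; left; apply/eqP; ring.
apply: ler_pM => //; apply: le_trans (ler_normD _ _) _; exact: lerD.
Qed.

End InnerProduct.

Section SteinIncrement.
Variables (R : realType) (H : nat) (H_gt0 : (0 < H)%N).
Variables (a b : R) (a_gt0 : 0 < a) (a_lt_b : a < b) (b_le1 : b <= 1).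
Variables (V : lmodType R) (dot : V -> V -> R) (ip : inner_product dot).
Implicit Types (u v D : V).
Local Notation P := (@chi2_cdf R H).
Local Notation psi := (stein_sol H a b).
Local Notation theta := (stein_dev H a b).
Local Notation L := (expR 1 * H%:R : R).
Local Notation nrm := (nrm dot).

(* The derivative of [s |-> dot D (u + s *: D) * psi (dot (u + s *: D) (u + s *: D))]
   at [s = 0]; the quotient is [0] when [dot u u = 0]. *)
Definition stein_form D u : R :=
  dot D D * psi (dot u u) + dot D u ^+ 2 / dot u u * theta (dot u u).

Definition stein_lip (h r : R) : R := 3 * h * stein_slope H a b r
  + L * h / (b - a) * ((a - L * h <= P (r ^+ 2)) && (P (r ^+ 2) <= b + L * h))%R%:R.

(** Thanks to the value [(1 - m) / H] of [psi] at 0. It makes the convention for the quotient in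
    [stein_form] harmless. *)
Lemma stein_dev0 : theta 0 = 0.
Proof.
rewrite /stein_dev (chi2_cdf_le0 H (lexx 0)) (ramp_lo a_lt_b (ltW a_gt0)).1 /stein_sol ltxx subr0.
by field; rewrite pnatr_eq0 -lt0n.
Qed.

Lemma stein_form_lipschitz u v D (h : R) : nrm (u - v) <= h -> h <= 1 -> L * h <= a / 2 ->
  `|stein_form D u - stein_form D v| <= dot D D * stein_lip h (nrm v).
Proof.
move=> uv h1 Lh; have h0 : 0 <= h := le_trans (nrm_ge0 dot _) uv.
have sr : `|nrm u - nrm v| <= h := le_trans (nrm_dist ip u v) uv.
have := stein_variation H_gt0 a_gt0 a_lt_b b_le1 (nrm_ge0 dot u) (nrm_ge0 dot v) sr h1 Lh.
rewrite !(nrm_sqr ip) -/(stein_lip h (nrm v)) => var.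
have D0 := dot_ge0 ip D.
have X : 0 <= dot D u ^+ 2 / dot u u <= dot D D.
  have := dot_ge0 ip u; rewrite le_eqVlt => /predU1P[<-|u0]; first by rewrite invr0 mulr0 lexx.
  rewrite divr_ge0 ?sqr_ge0 ?(ltW u0) //= ler_pdivrMr //; exact: cauchy_schwarz.
have k : `|(dot D u ^+ 2 / dot u u - dot D v ^+ 2 / dot v v) * theta (dot v v)|
    <= dot D D * (4 * h * (`|theta (dot v v)| / nrm v)).
  have := dot_ge0 ip v; rewrite le_eqVlt => /predU1P[<-|v0].
    by rewrite stein_dev0 normr0 mul0r !mulr0 normr0.
  rewrite normrM; apply: le_trans (_ : dot D D * (4 * h / nrm v) * `|theta (dot v v)| <= _).
    by rewrite ler_wpM2r // angle_le.
  by rewrite le_eqVlt; apply/orP; left; apply/eqP; ring.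
apply: (@le_trans _ _ (dot D D * (`|psi (dot u u) - psi (dot v v)|
  + `|theta (dot u u) - theta (dot v v)| + 4 * h * (`|theta (dot v v)| / nrm v)))); last first.
  by rewrite ler_wpM2l //; move: var; rewrite /stein_lip (nrm_sqr ip).
have -> : stein_form D u - stein_form D v = dot D D * (psi (dot u u) - psi (dot v v))
   + (dot D u ^+ 2 / dot u u * (theta (dot u u) - theta (dot v v))
   + (dot D u ^+ 2 / dot u u - dot D v ^+ 2 / dot v v) * theta (dot v v)).
  by rewrite /stein_form; ring.
rewrite [leRHS]mulrDr (mulrDr (dot D D) `|psi _ - psi _|) -[leRHS]addrA.
apply: le_trans (ler_normD _ _) _; apply: lerD.
  by rewrite normrM (ger0_norm D0).
apply: le_trans (ler_normD _ _) _; apply: lerD => //.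
rewrite normrM; case/andP: X => X0 X1; rewrite (ger0_norm X0).
by rewrite ler_wpM2r.
Qed.

(** The expansion is centred at a nearby [v] and not on the segment: [v] will be the assigned sum
    before two units are relabelled, so that the second-order term can be summed over relabellings
    with [v] held fixed. *)
Lemma stein_increment u v D (h : R) :
  (forall s : R, 0 <= s <= 1 -> nrm (u + s *: D - v) <= h) -> h <= 1 -> L * h <= a / 2 ->
  `|dot D (u + D) * psi (dot (u + D) (u + D)) - dot D u * psi (dot u u) - stein_form D v|
  <= dot D D * stein_lip h (nrm v).
Proof.
move=> seg h1 Lh.
have := dot_ge0 ip D; rewrite le_eqVlt => /predU1P[C0|C0].
  have z w : dot D w = 0.
    have := cauchy_schwarz ip D w; rewrite -C0 mul0r => q; apply/eqP.
    by rewrite -sqrf_eq0 eq_le q sqr_ge0.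
  by rewrite /stein_form !z expr0n /= !mul0r addr0 !subr0 normr0.
pose x (s : R) := dot (u + s *: D) (u + s *: D).
pose y (s : R) := dot D (u + s *: D).
have yE s : y s = dot D u + s * dot D D by rewrite /y (dotDr ip) (dotZr ip).
have xE s : x s = dot u u + (2 * dot D u * s + dot D D * s ^+ 2).
  by rewrite /x !(dotDl ip, dotDr ip, dotZl ip, dotZr ip) (dotC ip u D); ring.
have dy (s : R) : is_derive s 1 y (0 + 1 * dot D D).
  rewrite (_ : y = fun s => dot D u + s * dot D D); last by apply/funext.
  apply: is_derive1_eq (is_derive1D (is_derive1_cst (dot D u) s)
    (is_derive1M (is_derive1_id s) (is_derive1_cst (dot D D) s))) _.
  by ring.
have dx (s : R) : is_derive s 1 x (2 * y s).
  rewrite (_ : x = fun s => dot u u + (2 * dot D u * s + dot D D * s ^+ 2)); last by apply/funext.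
  apply: is_derive1_eq (is_derive1D (is_derive1_cst (dot u u) s)
    (is_derive1D (is_derive1Z (2 * dot D u) (is_derive1_id s)) (is_derive1Z (dot D D) (is_derive1_sqr s)))) _.
  by rewrite yE; ring.
have cf : continuous (fun s => y s * psi (x s)).
  move=> s; apply: (@continuousM R R y (fun s => psi (x s))); first exact: is_derive1_continuous (dy s).
  apply: (@continuous_comp _ _ _ x psi); first exact: is_derive1_continuous (dx s).
  exact: continuous_stein_sol.
(* The exceptional parameter is the zero of [y]. Where [y s != 0], the Cauchy-Schwarz inequality
   gives [x s > 0], hence differentiability. *)
have := @MVT_le_except R (fun s => y s * psi (x s)) (fun s => stein_form D (u + s *: D))
  (- dot D u / dot D D) (stein_form D v) (dot D D * stein_lip h (nrm v)) cf.
rewrite /x /y !scale1r !scale0r !addr0; apply=> s s01 sn.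
split; last first.
  by apply: stein_form_lipschitz => //; apply: seg; lra.
have ys : y s != 0.
  apply/eqP => ys; move/eqP: sn; apply; apply: (mulIf (_ : dot D D != 0)); first by rewrite gt_eqF.
  by rewrite divfK ?gt_eqF //; move: ys; rewrite yE; lra.
have xs : 0 < x s.
  have q := cauchy_schwarz ip D (u + s *: D).
  have : 0 < dot D D * x s by apply: lt_le_trans q; rewrite exprn_even_gt0.
  by rewrite pmulr_rgt0.
have d1 := is_derive1M (dy s) (is_derive1_chain (f := psi) (g := x)
    (is_derive1_stein_sol H_gt0 a_lt_b xs) (dx s)).
apply: is_derive1_eq d1 _.
rewrite /stein_form -/(x s) -/(y s); field; by rewrite gt_eqF.
Qed.

End SteinIncrement.

(** * Exchanging treatment labels *)

Section Permutation.
Variables (N Q : nat) (Nq : 'I_Q -> nat).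
Implicit Types (Z : {ffun 'I_N -> 'I_Q}) (s t : 'S_N).

Definition permute s Z : {ffun 'I_N -> 'I_Q} := [ffun i => Z (s i)].

Lemma permuteM s t Z : permute (s * t)%g Z = permute s (permute t Z).
Proof. by apply/ffunP => i; rewrite !ffunE permM. Qed.

Lemma permute_inj s : injective (permute s).
Proof.
move=> Z Z' /ffunP e; apply/ffunP => i.
by have := e (s^-1%g i); rewrite !ffunE permKV.
Qed.

Lemma admissible_permute s Z : admissible Nq (permute s Z) = admissible Nq Z.
Proof.
apply: eq_forallb => q; congr (_ == _).
rewrite -[RHS](card_imset _ (@perm_inj _ s^-1%g)); apply: eq_card => i.
apply/idP/imsetP => [|[j]]; rewrite !inE.
  by rewrite ffunE => h; exists (s i); rewrite ?inE ?permK.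
by move=> h ->; rewrite ffunE permKV.
Qed.

Lemma sum_permute (R : nmodType) (f : {ffun 'I_N -> 'I_Q} -> R) s :
  \sum_(Z | admissible Nq Z) f (permute s Z) = \sum_(Z | admissible Nq Z) f Z.
Proof.
rewrite [RHS](reindex_inj (h := permute s) (@permute_inj s)).
by apply: eq_bigl => Z; rewrite admissible_permute.
Qed.

Lemma sum_admissible (R : pzSemiRingType) Z (f : 'I_Q -> R) : admissible Nq Z ->
  \sum_i f (Z i) = \sum_q (Nq q)%:R * f q.
Proof.
move=> /forallP aZ; rewrite (partition_big Z xpredT) //=; apply: eq_bigr => q _.
rewrite (eq_bigr (fun=> f q)); last by move=> i /eqP ->.
rewrite sumr_const -[LHS]mulr_natl -(eqP (aZ q)).
by congr (_ * _); congr (_%:R); apply: eq_card => i; rewrite !inE.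
Qed.

(* Under [permute (two_point i j k l)] the units [i] and [j] receive the labels
   of [k] and [l], and the sum over all [k != l] of a function of these two
   labels is the same for all admissible [Z]. *)
Definition two_point (i j k l : 'I_N) : 'S_N := (tperm i k * tperm (tperm i k j) l)%g.

Lemma two_pointE i j k l : i != j -> k != l ->
  two_point i j k l i = k /\ two_point i j k l j = l.
Proof.
move=> ij kl; rewrite /two_point !permM tpermL tpermL; split => //.
have h : tperm i k j != k.
  by apply: contra ij => /eqP e; rewrite -(inj_eq (@perm_inj _ (tperm i k))) tpermL e.
by apply: tpermD; rewrite // eq_sym.
Qed.

End Permutation.

Section FourfoldSums.
Variables (R : numDomainType) (N : nat).
Implicit Types f g h : 'I_N -> 'I_N -> 'I_N -> 'I_N -> R.

Definition sum4 f : R := \sum_i \sum_j \sum_k \sum_l f i j k l.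

Lemma eq_sum4 f g : (forall i j k l, f i j k l = g i j k l) -> sum4 f = sum4 g.
Proof. by move=> e; do 4!(apply: eq_bigr => ? _). Qed.

Lemma sum4_dist_le f g h : (forall i j k l, `|f i j k l - g i j k l| <= h i j k l) ->
  `|sum4 f - sum4 g| <= sum4 h.
Proof.
move=> e; rewrite /sum4.
do 4!(rewrite -sumrB; apply: le_trans (ler_norm_sum _ _ _) _; apply: ler_sum => ? _).
exact: e.
Qed.

Lemma sum4_exchange (T : finType) (A : pred T) (f : T -> 'I_N -> 'I_N -> 'I_N -> 'I_N -> R) :
  \sum_(z | A z) sum4 (f z) = sum4 (fun i j k l => \sum_(z | A z) f z i j k l).
Proof. by rewrite /sum4; do 3!(rewrite exchange_big /=; apply: eq_bigr => ? _); rewrite exchange_big. Qed.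

Lemma sum4Ml (c : R) f : c * sum4 f = sum4 (fun i j k l => c * f i j k l).
Proof. by rewrite /sum4; do 3!(rewrite mulr_sumr; apply: eq_bigr => ? _); rewrite mulr_sumr. Qed.

Lemma sum4D f g : sum4 f + sum4 g = sum4 (fun i j k l => f i j k l + g i j k l).
Proof. by rewrite /sum4; do 3!(rewrite -big_split; apply: eq_bigr => ? _); rewrite -big_split. Qed.

End FourfoldSums.

(** * The exchangeable pair and the summed Stein equation *)

Section Exchange.
Variables (R : realType) (N Q : nat) (Nq : 'I_Q -> nat).
Variables (V : lmodType R) (dot : V -> V -> R) (ip : inner_product dot).
Variables (al : 'I_N -> 'I_Q -> V) (al_sum0 : forall q, \sum_i al i q = 0).
Implicit Types (Z : {ffun 'I_N -> 'I_Q}) (i j k l : 'I_N) (q : 'I_Q).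
Local Notation nrm := (nrm dot).

Definition assigned_sum Z : V := \sum_i al i (Z i).
Definition swap_diff i j q q' : V := al i q' + al j q - al i q - al j q'.
Local Notation U := assigned_sum.
Local Notation D := swap_diff.

Lemma swap_diffE i j q q' : D i j q q' = (al i q' + al j q) - (al i q + al j q').
Proof. by rewrite /D -addrA -opprD. Qed.

Lemma swap_diff_eql i q q' : D i i q q' = 0.
Proof. by rewrite /D -addrA -opprD [al i q + _]addrC subrr. Qed.

Lemma swap_diff_eqr i j q : D i j q q = 0.
Proof. by rewrite /D -addrA -opprD subrr. Qed.

Lemma assigned_sum_tperm i j Z : U (permute (tperm i j) Z) = U Z + D i j (Z i) (Z j).
Proof.
have [<-|ij] := eqVneq i j.
  rewrite swap_diff_eql addr0; congr U; apply/ffunP => k.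
  by rewrite ffunE tperm1 perm1.
have ji : j != i by rewrite eq_sym.
rewrite /U (bigD1 i) //= (bigD1 j) //= [in RHS](bigD1 i) //= [in RHS](bigD1 j) //=.
rewrite !ffunE tpermL tpermR (eq_bigr (fun k => al k (Z k))); last first.
  by move=> k /andP[ki kj]; rewrite ffunE tpermD // eq_sym.
rewrite /D.
set a1 := al i (Z i); set a2 := al j (Z j); set a3 := al i (Z j); set a4 := al j (Z i).
set S := \sum_(_ | _) _.
have -> : a3 + a4 - a1 - a2 = (a3 + a4) - (a1 + a2) by rewrite opprD addrA.
by rewrite (addrA a3 a4 S) (addrA a1 a2 S) [RHS]addrC (addrA _ (a1 + a2) S) subrK.
Qed.

(** The linear regression property of the exchangeable pair. The cross terms vanish since the
    effects of each label sum to zero over the units. *)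
Lemma sum_swap_diff Z : \sum_i \sum_j D i j (Z i) (Z j) = - (2 * N%:R) *: U Z.
Proof.
have e1 : \sum_i \sum_j al i (Z j) = 0.
  by rewrite exchange_big /= big1.
have e2 : \sum_(i < N) \sum_(j < N) al j (Z i) = 0 by rewrite big1.
have e3 : \sum_(i < N) \sum_(j < N) al i (Z i) = N%:R *: U Z.
  by rewrite scaler_sumr; apply: eq_bigr => i _; rewrite sumr_const card_ord scaler_nat.
have e4 : \sum_(i < N) \sum_(j < N) al j (Z j) = N%:R *: U Z.
  by rewrite sumr_const card_ord scaler_nat.
rewrite /D; under eq_bigr => i _ do rewrite !big_split /= !sumrN.
rewrite !big_split /= !sumrN e1 e2 e3 e4 addr0 add0r -opprD -scalerDl -scaleNr.
by congr (_ *: _); ring.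
Qed.

Definition exchange_term (phi : R -> R) i j Z : R :=
  dot (D i j (Z i) (Z j)) (U Z + D i j (Z i) (Z j))
    * phi (dot (U Z + D i j (Z i) (Z j)) (U Z + D i j (Z i) (Z j)))
  - dot (D i j (Z i) (Z j)) (U Z) * phi (dot (U Z) (U Z)).

(** Swapping [i] and [j] preserves the admissible assignments and maps [U] to [U + D] and [D] to
    [- D]. The two halves of [exchange_term] thus have the same sum, and linear regression evaluates
    it. *)
Lemma exchange_identity (phi : R -> R) :
  4 * N%:R * (\sum_(Z | admissible Nq Z) dot (U Z) (U Z) * phi (dot (U Z) (U Z)))
  = \sum_i \sum_j \sum_(Z | admissible Nq Z) exchange_term phi i j Z.
Proof.
pose g Z := phi (dot (U Z) (U Z)).
have key i j : \sum_(Z | admissible Nq Z) exchange_term phi i j Z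
   = - 2 * \sum_(Z | admissible Nq Z) dot (D i j (Z i) (Z j)) (U Z) * g Z.
  rewrite /exchange_term sumrB (_ : \sum_(Z | _) _ =
    - \sum_(Z | admissible Nq Z) dot (D i j (Z i) (Z j)) (U Z) * g Z).
    by rewrite mulNr -opprD mulr_natl mulr2n.
  rewrite -[in RHS](sum_permute _ _ (tperm i j)) -sumrN; apply: eq_bigr => Z _.
  rewrite /g !assigned_sum_tperm !ffunE tpermL tpermR -mulNr -(dotNl ip); congr (dot _ _ * _).
  by rewrite !swap_diffE opprB.
transitivity (- 2 * \sum_i \sum_j \sum_(Z | admissible Nq Z) dot (D i j (Z i) (Z j)) (U Z) * g Z).
  have -> : \sum_i \sum_j \sum_(Z | admissible Nq Z) dot (D i j (Z i) (Z j)) (U Z) * g Z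
      = \sum_(Z | admissible Nq Z) dot (\sum_i \sum_j D i j (Z i) (Z j)) (U Z) * g Z.
    under [RHS]eq_bigr => Z _ do rewrite (dot_suml ip) mulr_suml.
    rewrite [RHS]exchange_big /=; apply: eq_bigr => i _.
    under [RHS]eq_bigr => Z _ do rewrite (dot_suml ip) mulr_suml.
    by rewrite [RHS]exchange_big.
  rewrite !mulr_sumr; apply: eq_bigr => Z _.
  by rewrite sum_swap_diff (dotZl ip) /g; ring.
rewrite mulr_sumr; apply: eq_bigr => i _; rewrite mulr_sumr; apply: eq_bigr => j _.
by rewrite key.
Qed.

Lemma sum_two_point (f : {ffun 'I_N -> 'I_Q} -> R) i j :
  N%:R * (N%:R - 1) * (\sum_(Z | admissible Nq Z) f Z)
  = \sum_k \sum_(l | l != k) \sum_(Z | admissible Nq Z) f (permute (two_point i j k l) Z).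
Proof.
under [RHS]eq_bigr => k _ do under eq_bigr => l _ do rewrite sum_permute.
under [RHS]eq_bigr => k _ do rewrite sumr_const cardC1 card_ord -mulr_natl.
rewrite [RHS]sumr_const card_ord -[RHS]mulr_natl mulrA; congr (_ * _ * _).
by case: (N) i => [[]//|n] _; rewrite /= -natr1 addrK.
Qed.

Variables (delta : R) (al_le : forall i q, nrm (al i q) <= delta).

Lemma swap_diff_le i j q q' : nrm (D i j q q') <= 4 * delta.
Proof.
rewrite /D; have := al_le i q'; have := al_le j q; have := al_le i q; have := al_le j q'.
have h1 := nrmD ip (al i q' + al j q - al i q) (- al j q').
have h2 := nrmD ip (al i q' + al j q) (- al i q).
have h3 := nrmD ip (al i q') (al j q).
rewrite !(nrmN ip) in h1 h2; lra.
Qed.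

Lemma assigned_sum_two_point i j k l Z :
  nrm (U (permute (two_point i j k l) Z) - U Z) <= 8 * delta.
Proof.
rewrite /two_point permuteM !assigned_sum_tperm -[U Z + _ + _]addrA (addrAC (U Z)) subrr add0r.
apply: le_trans (nrmD ip _ _) _.
apply: le_trans (lerD (swap_diff_le _ _ _ _) (swap_diff_le _ _ _ _)) _; lra.
Qed.

Variables (c : R) (H : nat).
Hypothesis trace_swap : forall Z, admissible Nq Z ->
  sum4 (fun i j k l => dot (D i j (Z k) (Z l)) (D i j (Z k) (Z l))) = c * H%:R.

(** [sum_two_point] replaces [Z] by assignments in which [i] and [j] carry the labels of [k] and
    [l]: the increment becomes [D i j (Z k) (Z l)], while [form] and [lip] stay at the original
    [U Z]. For fixed [Z] the errors then sum to [lip (U Z)] times the constant of [trace_swap]. The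
    pairs [k = l], absent from the relabellings, can be added because their increment is zero. *)
Lemma exchange_bound (phi : R -> R) (form : V -> V -> R) (lip : V -> R) :
  (forall v, form 0 v = 0) ->
  (forall u v d, nrm (u - v) <= 8 * delta -> nrm d <= 4 * delta ->
    `|dot d (u + d) * phi (dot (u + d) (u + d)) - dot d u * phi (dot u u) - form d v|
    <= dot d d * lip v) ->
  `|4 * N%:R * (N%:R * (N%:R - 1)) * (\sum_(Z | admissible Nq Z) dot (U Z) (U Z) * phi (dot (U Z) (U Z)))
    - \sum_(Z | admissible Nq Z) sum4 (fun i j k l => form (D i j (Z k) (Z l)) (U Z))|
  <= c * H%:R * \sum_(Z | admissible Nq Z) lip (U Z).
Proof.
move=> form0 bnd.
have -> : 4 * N%:R * (N%:R * (N%:R - 1))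
     * (\sum_(Z | admissible Nq Z) dot (U Z) (U Z) * phi (dot (U Z) (U Z)))
   = sum4 (fun i j k l => if l != k then \sum_(Z | admissible Nq Z)
       exchange_term phi i j (permute (two_point i j k l) Z) else 0).
  rewrite mulrAC exchange_identity mulrC mulr_sumr; apply: eq_bigr => i _.
  rewrite mulr_sumr; apply: eq_bigr => j _; rewrite (sum_two_point _ i j).
  by apply: eq_bigr => k _; rewrite big_mkcond.
rewrite sum4_exchange.
have -> : c * H%:R * \sum_(Z | admissible Nq Z) lip (U Z) =
    sum4 (fun i j k l => \sum_(Z | admissible Nq Z)
      dot (D i j (Z k) (Z l)) (D i j (Z k) (Z l)) * lip (U Z)).
  rewrite -sum4_exchange mulr_sumr; apply: eq_bigr => Z aZ.
  rewrite -(trace_swap aZ) mulrC sum4Ml; apply: eq_sum4 => i j k l; exact: mulrC.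
apply: sum4_dist_le => i j k l.
have [->|lk] := eqVneq l k.
  rewrite /= !big1 ?subrr ?normr0 // => Z _; first by rewrite swap_diff_eqr (dot0l ip) mul0r.
  by rewrite swap_diff_eqr form0.
rewrite /= -sumrB; apply: le_trans (ler_norm_sum _ _ _) _; apply: ler_sum => Z _.
have [->|ij] := eqVneq i j.
  by rewrite /exchange_term !swap_diff_eql form0 !(dot0l ip) !mul0r !subr0 normr0.
rewrite eq_sym in lk; have [Zi Zj] := two_pointE ij lk.
rewrite /exchange_term [permute _ _ i]ffunE [permute _ _ j]ffunE Zi Zj.
by apply: bnd; [exact: assigned_sum_two_point | exact: swap_diff_le].
Qed.

Hypothesis c_eq : c = 4 * N%:R * (N%:R * (N%:R - 1)).
Hypothesis N_gt1 : (1 < N)%N.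

Let c_gt0 : 0 < c.
Proof.
have n1 : 1 < N%:R :> R by rewrite ltr1n.
have n0 : 0 < N%:R :> R := lt_trans ltr01 n1.
by rewrite c_eq !mulr_gt0 ?subr_gt0.
Qed.

(** For [phi = 1] the expansion of the increment has no remainder, which allows [lip = 0]. *)
Lemma second_moment : \sum_(Z | admissible Nq Z) dot (U Z) (U Z)
  = H%:R * \sum_(Z : {ffun 'I_N -> 'I_Q} | admissible Nq Z) 1.
Proof.
have c0 : c != 0 by rewrite gt_eqF.
apply: (mulfI c0).
have h := @exchange_bound (fun=> 1) (fun d _ => dot d d) (fun=> 0).
apply/eqP; rewrite -subr_eq0 -normr_le0.
have -> : c * (H%:R * \sum_(Z : {ffun 'I_N -> 'I_Q} | admissible Nq Z) 1) =
    \sum_(Z | admissible Nq Z) sum4 (fun i j k l => dot (D i j (Z k) (Z l)) (D i j (Z k) (Z l))).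
  by rewrite mulrA mulr_sumr; apply: eq_bigr => Z aZ; rewrite trace_swap // mulr1.
move: h; rewrite -c_eq big1_eq mulr0.
under eq_bigr do rewrite mulr1.
apply; first by move=> _; exact: dot0l.
by move=> u v d _ _; rewrite !mulr1 (dotDr ip) mulr0 (_ : _ - _ = 0) ?normr0 //; ring.
Qed.

Section Stein.
Hypothesis H_gt0 : (0 < H)%N.
Variables (a b : R) (a_gt0 : 0 < a) (a_lt_b : a < b) (b_le1 : b <= 1).
Hypothesis cov : forall Z, admissible Nq Z -> forall v,
  sum4 (fun i j k l => dot (D i j (Z k) (Z l)) v ^+ 2) = c * dot v v.
Local Notation P := (@chi2_cdf R H).

(** By [trace_swap] and [cov] the second-order term sums to [c (H psi + theta)] at [x = |U|^2];
    subtracting [c x psi] leaves [c (ramp - m)], by the definition of [theta]. *)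
Lemma stein_bound : 12 * delta <= 1 -> expR 1 * H%:R * (12 * delta) <= a / 2 ->
  `|\sum_(Z | admissible Nq Z) (ramp a b (P (dot (U Z) (U Z))) - ramp_mean a b)|
  <= H%:R * \sum_(Z | admissible Nq Z) stein_lip H a b (12 * delta) (nrm (U Z)).
Proof.
move=> d1 Ld.
pose psi := stein_sol H a b; pose theta := stein_dev H a b.
have h := @exchange_bound psi (stein_form H a b dot) (fun v => stein_lip H a b (12 * delta) (nrm v)).
rewrite -(ler_pM2l c_gt0) mulrA -{1}(gtr0_norm c_gt0) -normrM mulr_sumr -normrN -sumrN.
have e Z : admissible Nq Z -> sum4 (fun i j k l => stein_form H a b dot (D i j (Z k) (Z l)) (U Z))
    = c * (H%:R * psi (dot (U Z) (U Z)) + theta (dot (U Z) (U Z))).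
  move=> aZ; set x := dot (U Z) (U Z).
  transitivity (psi x * sum4 (fun i j k l => dot (D i j (Z k) (Z l)) (D i j (Z k) (Z l)))
      + theta x / x * sum4 (fun i j k l => dot (D i j (Z k) (Z l)) (U Z) ^+ 2)).
    rewrite !sum4Ml sum4D; apply: eq_sum4 => i j k l.
    by rewrite /stein_form -/x -/psi -/theta; congr (_ + _); ring.
  rewrite trace_swap // cov // -/x; have [->|x0] := eqVneq x 0.
    by rewrite /theta stein_dev0 //; ring.
  by field.
rewrite (_ : \sum_(Z | _) - _ = c * (\sum_(Z | admissible Nq Z) dot (U Z) (U Z) * psi (dot (U Z) (U Z)))
    - \sum_(Z | admissible Nq Z) sum4 (fun i j k l => stein_form H a b dot (D i j (Z k) (Z l)) (U Z))).
  rewrite -c_eq in h; apply: h.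
    by move=> v; rewrite /stein_form !(dot0l ip) expr0n /= !mul0r addr0.
  (* Relabelling moves the sum by at most [8 delta], the swap itself by at most [4 delta]: hence
     12. *)
  move=> u v d uv dd; apply: stein_increment => // s /andP[s0 s1].
  rewrite addrAC; apply: le_trans (nrmD ip _ _) _; rewrite (nrmZ ip) (ger0_norm s0).
  have := nrm_ge0 dot d; nra.
rewrite mulr_sumr -sumrB; apply: eq_bigr => Z aZ; rewrite e //.
rewrite /theta /stein_dev -/psi; ring.
Qed.
End Stein.

End Exchange.

(** * Bootstrapping the Kolmogorov distance *)

Section Mean.
Variables (R : realFieldType) (T : finType) (A : {pred T}).
Hypothesis A_gt0 : (0 < #|A|)%N.
Implicit Types (f g : T -> R) (k : R).

Definition mean f : R := (\sum_(z in A) f z) / #|A|%:R.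

Lemma meanD f g : mean (fun z => f z + g z) = mean f + mean g.
Proof. by rewrite /mean big_split /= mulrDl. Qed.
Lemma meanZ k f : mean (fun z => k * f z) = k * mean f.
Proof. by rewrite /mean -mulr_sumr mulrA. Qed.
Lemma mean_cst k : mean (fun=> k) = k.
Proof. by rewrite /mean sumr_const -[X in X / _]mulr_natr mulfK // pnatr_eq0 -lt0n. Qed.
Lemma meanB f g : mean (fun z => f z - g z) = mean f - mean g.
Proof. by rewrite /mean sumrB mulrBl. Qed.
Lemma le_mean f g : (forall z, z \in A -> f z <= g z) -> mean f <= mean g.
Proof. by move=> fg; rewrite /mean ler_wpM2r ?invr_ge0 // ler_sum. Qed.
Lemma eq_mean f g : (forall z, z \in A -> f z = g z) -> mean f = mean g.
Proof. by move=> fg; rewrite /mean (eq_bigr _ fg). Qed.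
Lemma mean_ge0 f : (forall z, z \in A -> 0 <= f z) -> 0 <= mean f.
Proof. by move=> f0; rewrite /mean divr_ge0 // sumr_ge0. Qed.

End Mean.

Section Bootstrap.
Variables (R : realType) (T : finType) (A : {pred T}).
Hypothesis A_gt0 : (0 < #|A|)%N.
Variables (H : nat) (H_gt0 : (0 < H)%N) (r : T -> R) (h : R).
Local Notation P := (@chi2_cdf R H).
Local Notation L := (expR 1 * H%:R : R).
Local Notation E := (mean A).
Let V z : R := P (r z ^+ 2).
Hypothesis r_ge0 : forall z, z \in A -> 0 <= r z.
Hypothesis r_sqr : E (fun z => r z ^+ 2) = H%:R.
Hypothesis h_gt0 : 0 < h.
Hypothesis stein : forall a b : R, 0 < a -> a < b -> b <= 1 -> L * h <= a / 2 ->
  `|E (fun z => ramp a b (V z)) - ramp_mean a b| <= H%:R * E (fun z => stein_lip H a b h (r z)).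
Implicit Types (x k c : R).

Let F x : R := E (fun z => (V z <= x)%R%:R).
Let V01 z : 0 <= V z /\ V z <= 1.
Proof. by split; [exact: chi2_cdf_ge0 | exact: chi2_cdf_le1]. Qed.

Let F_le x y : x <= y -> F x <= F y.
Proof.
move=> xy; apply: le_mean => z _; rewrite ler_nat.
by case: (leP (V z) x) => // vx; rewrite (le_trans vx xy).
Qed.

Let F01 x : 0 <= F x /\ F x <= 1.
Proof.
split; first exact: mean_ge0.
by rewrite -[leRHS](mean_cst A_gt0); apply: le_mean => z _; rewrite lern1 leq_b1.
Qed.

Section Step.
Variable k : R.
Hypothesis Fk : forall x, 0 <= x <= 1 -> `|F x - x| <= k.

Let k_ge0 : 0 <= k.
Proof. by apply: le_trans (Fk (x := 0) _) => //; rewrite lexx ler01. Qed.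

Let F_ub x : 0 <= x -> F x <= x + k.
Proof.
move=> x0; have k0 := k_ge0; have [x1|x1] := leP x 1.
  by have := @Fk x; rewrite x0 x1 => /(_ isT); rewrite ler_norml => /andP[_]; lra.
by have [_] := F01 x; lra.
Qed.

Let F_lb x : 0 <= x <= 1 -> x - k <= F x.
Proof. by move=> /Fk; rewrite ler_norml => /andP[]; lra. Qed.

(* On [(c, 2 c]] the integrand is at most [c^-2], and [F_ub] bounds the mass. *)
Let inv_sqr_dyadic (J : nat) c : 0 < c ->
  E (fun z => ((c < V z) && (V z <= 2 ^+ J * c))%R%:R / V z ^+ 2) <= 4 / c + 4 / 3 * k / c ^+ 2.
Proof.
have k0 := k_ge0; elim: J c => [|J IH] c c0.
  rewrite expr0 mul1r (eq_mean (g := fun=> 0)) ?mean_cst //.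
    by rewrite addr_ge0 // ?divr_ge0 ?mulr_ge0 // ltW // exprn_gt0.
  by move=> z _; case: ltP => //= cv; rewrite ?leNgt ?cv ?mul0r.
apply: (@le_trans _ _ (E (fun z => c ^- 2 * (V z <= 2 * c)%R%:R
   + ((2 * c < V z) && (V z <= 2 ^+ J * (2 * c)))%R%:R / V z ^+ 2))).
  apply: le_mean => z _; have [cv|cv] := ltP c (V z); last first.
    by rewrite /= mul0r addr_ge0 ?mulr_ge0 ?invr_ge0 // sqr_ge0.
  have v0 : 0 < V z by apply: lt_trans cv.
  rewrite mulrA -exprSr; have [v2|v2] := ltP (2 * c) (V z).
    by rewrite /= mulr0 add0r.
  rewrite /= mulr1 mul0r addr0; case: (leP (V z) (2 ^+ J.+1 * c)) => _; last first.
    by rewrite mul0r invr_ge0 sqr_ge0.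
  by rewrite mul1r lef_pV2 ?posrE ?exprn_gt0 // ler_sqr ?nnegrE ltW.
rewrite meanD meanZ -/(F _).
have := IH (2 * c); rewrite mulr_gt0 // => /(_ isT) h2.
have h1 : c ^- 2 * F (2 * c) <= 2 / c + k / c ^+ 2.
  rewrite mulrC ler_pdivrMr ?exprn_gt0 //.
  have -> : (2 / c + k / c ^+ 2) * c ^+ 2 = 2 * c + k by field; lra.
  by apply: F_ub; lra.
have e : 4 / (2 * c) + 4 / 3 * k / (2 * c) ^+ 2 = 2 / c + k / 3 / c ^+ 2 by field; lra.
rewrite e in h2; apply: le_trans (lerD h1 h2) _.
by rewrite le_eqVlt; apply/orP; left; apply/eqP; field; lra.
Qed.

Let inv_sqr_tail c : 0 < c ->
  E (fun z => (c < V z)%R%:R / V z ^+ 2) <= 4 / c + 4 / 3 * k / c ^+ 2.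
Proof.
move=> c0; pose J := (Num.trunc c^-1).+1.
have cJ : 1 <= 2 ^+ J * c.
  rewrite -ler_pdivrMr // mul1r; apply: ltW; apply: lt_le_trans (truncnS_gt _) _.
  by rewrite -natrX ler_nat ltnW // ltn_expl.
apply: le_trans (inv_sqr_dyadic J c0); apply: le_mean => z _.
by rewrite (le_trans (V01 z).2 cJ) andbT.
Qed.

Let mean_r : E r <= H%:R.
Proof.
have H1 : 1 <= H%:R :> R by rewrite ler1n.
apply: (@le_trans _ _ (E (fun z => 2^-1 * (1 + r z ^+ 2)))).
  by apply: le_mean => z _; have := sqr_ge0 (r z - 1); lra.
by rewrite meanZ meanD mean_cst // r_sqr; lra.
Qed.

(* Any upper bound for the constants collected in [step_bound] would do. *)
Definition bootstrap_const : R :=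
  36 + 6 * (12 + 2 * expR 2) + 972 * expR 1 + 3 * expR 1 + 648 * expR 1 + 2 * expR 1.

(** The condition [b - a <= a] keeps the mean of the ramp below [3 a / 2], which compensates the
    [1 / a] of the inverse-square tail; [2 L h <= b - a] keeps the widened interval comparable with
    [b - a]. Each mean is then a constant plus a multiple of [k / (b - a)], up to its scale. *)
Let step_bound a b : 0 < a -> a < b -> b <= 1 -> L * h <= a / 2 -> b - a <= a -> 2 * (L * h) <= b - a ->
  `|E (fun z => ramp a b (V z)) - ramp_mean a b|
  <= bootstrap_const * H%:R ^+ 3 * h * (1 + k / (b - a)).
Proof.
move=> a0 ab b1 La ba Lba; apply: le_trans (stein a0 ab b1 La) _.
have k0 := k_ge0; have H1 : 1 <= H%:R :> R by rewrite ler1n.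
have h0 := h_gt0; have E1 := expR_gt0 (1 : R); have E2 := expR_gt0 (2 : R).
set eps := b - a in ba Lba *; set eta := L * h in La Lba *.
have eps0 : 0 < eps by rewrite /eps; lra.
have eta0 : 0 < eta by rewrite /eta !mulr_gt0 //; lra.
have m1 : 0 < ramp_mean a b <= 3 / 2 * a by rewrite /ramp_mean; rewrite /eps in ba; lra.
have k1 : E (fun z => ramp_mean a b / V z ^+ 2 * (a / 2 < V z)%R%:R) <= 12 + 8 * (k / eps).
  rewrite (eq_mean (g := fun z => ramp_mean a b * ((a / 2 < V z)%R%:R / V z ^+ 2))); last first.
    by move=> z _; rewrite mulrAC mulrA.
  rewrite meanZ.
  have a2 : 0 < a / 2 by lra.
  apply: (@le_trans _ _ (3 / 2 * a * (4 / (a / 2) + 4 / 3 * k / (a / 2) ^+ 2))).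
    apply: ler_pM; [lra| |lra|exact: inv_sqr_tail].
    by apply: mean_ge0 => z _; rewrite divr_ge0 // sqr_ge0.
  have -> : 3 / 2 * a * (4 / (a / 2) + 4 / 3 * k / (a / 2) ^+ 2) = 12 + 8 * (k / a) by field; lra.
  by rewrite lerD2l ler_pM2l // ler_wpM2l // lef_pV2 ?posrE.
(* The interval is closed on the left whereas [F] counts [V <= x], so [F] is taken slightly lower,
   at [a - 2 eta], which is still nonnegative. *)
have k2 : E (fun z => ((a - eta <= V z) && (V z <= b + eta))%R%:R) <= eps + 3 * eta + 2 * k.
  apply: (@le_trans _ _ (F (b + eta) - F (a - 2 * eta))).
    rewrite -meanB; apply: le_mean => z _.
    case: (leP (a - eta) (V z)) => v1 /=; last first.
      rewrite subr_ge0 ler_nat; case: (leP (V z) (a - 2 * eta)) => // v2.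
      by rewrite (_ : V z <= b + eta) //; lra.
    by rewrite [V z <= a - _]leNgt (_ : a - 2 * eta < V z) ?subr0 //; lra.
  have := @F_ub (b + eta); have := @F_lb (a - 2 * eta); rewrite /eps.
  by move=> g1 g2; have := g1 _; have := g2 _; lra.
have kr := mean_r.
have -> : E (fun z => stein_lip H a b h (r z)) =
  3 * h * (12 * H%:R + (12 + 2 * expR 2) * (E r + 1)
   + 27 * expR 1 * H%:R ^+ 2 * E (fun z => ramp_mean a b / V z ^+ 2 * (a / 2 < V z)%R%:R))
  + eta / eps * E (fun z => ((a - eta <= V z) && (V z <= b + eta))%R%:R).
  rewrite /stein_lip meanD meanZ meanZ; congr (_ + _); congr (_ * _).
  by rewrite /stein_slope meanD meanD mean_cst // !meanZ meanD mean_cst.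
move: k1 k2; set X := E _; set Y := E _ => k1 k2.
set q := k / eps in k1 *.
have q0 : 0 <= q by rewrite divr_ge0 // ltW.
have kq : k = q * eps by rewrite divfK // gt_eqF.
set n := H%:R in H1 kr *.
have l1 : eta / eps * Y <= expR 1 * n * h * (5 / 2 + 2 * q).
  apply: (@le_trans _ _ (eta / eps * (eps * (5 / 2 + 2 * q)))).
    rewrite ler_wpM2l //; first by rewrite divr_ge0 // ltW.
    by apply: le_trans k2 _; rewrite kq; nra.
  by rewrite mulrA divfK ?gt_eqF.
have l2 : 3 * h * (12 * n + (12 + 2 * expR 2) * (E r + 1) + 27 * expR 1 * n ^+ 2 * X)
  <= 3 * h * (n ^+ 2 * (12 + 2 * (12 + 2 * expR 2) + 27 * expR 1 * (12 + 8 * q))).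
  rewrite ler_pM2l; last by rewrite mulr_gt0.
  have n2 : n <= n ^+ 2 by nra.
  have j1 : 12 * n <= 12 * n ^+ 2 by lra.
  have j2 : (12 + 2 * expR 2) * (E r + 1) <= n ^+ 2 * (2 * (12 + 2 * expR 2)).
    by rewrite mulrC; nra.
  have j3 : 27 * expR 1 * n ^+ 2 * X <= n ^+ 2 * (27 * expR 1 * (12 + 8 * q)).
    have -> : n ^+ 2 * (27 * expR 1 * (12 + 8 * q)) = 27 * expR 1 * n ^+ 2 * (12 + 8 * q) by ring.
    by rewrite ler_wpM2l // mulr_ge0 ?sqr_ge0 //; lra.
  by lra.
apply: (@le_trans _ _ (n * (n ^+ 2 * h * (bootstrap_const * (1 + q))))); last first.
  by rewrite le_eqVlt; apply/orP; left; apply/eqP; ring.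
rewrite ler_pM2l; last by lra.
apply: le_trans (lerD l2 l1) _.
have l3 : expR 1 * n * h * (5 / 2 + 2 * q) <= n ^+ 2 * h * (expR 1 * (5 / 2 + 2 * q)).
  have -> : expR 1 * n * h * (5 / 2 + 2 * q) = n * (h * (expR 1 * (5 / 2 + 2 * q))) by ring.
  rewrite -(mulrA (n ^+ 2)) ler_wpM2r //; last by nra.
  by rewrite !mulr_ge0 //; lra.
apply: le_trans (lerD (lexx _) l3) _.
have -> : 3 * h * (n ^+ 2 * (12 + 2 * (12 + 2 * expR 2) + 27 * expR 1 * (12 + 8 * q))) +
  n ^+ 2 * h * (expR 1 * (5 / 2 + 2 * q)) =
  n ^+ 2 * h * (3 * (12 + 2 * (12 + 2 * expR 2) + 27 * expR 1 * (12 + 8 * q)) + expR 1 * (5 / 2 + 2 * q)) by ring.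
rewrite ler_wpM2l //; first by rewrite mulr_ge0 ?sqr_ge0 // ltW.
rewrite /bootstrap_const.
have : 0 <= expR 1 * q by rewrite mulr_ge0 // ltW.
have : 0 <= expR 2 * q by rewrite mulr_ge0 // ltW.
by lra.
Qed.

(** The ramp width for which [step_bound] reads [eps / 4 + k / 4]. *)
Let eps : R := 4 * bootstrap_const * H%:R ^+ 3 * h.

(** Ramps of width [eps] on either side of [x] sandwich the indicator; their means are off by
    [eps / 2]. Near the ends of the unit interval, where no such ramp is available, monotonicity and
    [0 <= F <= 1] suffice, at a total cost below [2 eps]. *)
Lemma bootstrap_step x : 0 <= x <= 1 -> `|F x - x| <= 2 * eps + k / 4.
Proof.
move=> /andP[x0 x1].
have k0 := k_ge0; have H1 : 1 <= H%:R :> R by rewrite ler1n.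
have h0 := h_gt0; have E1 := expR_gt0 (1 : R); have E2 := expR_gt0 (2 : R).
have C0 : 2 * expR 1 + 1 <= bootstrap_const by rewrite /bootstrap_const; lra.
have eps0 : 0 < eps by rewrite /eps !mulr_gt0 ?exprn_gt0 //; lra.
have [F0 F1] := F01 x.
have [e1|e1] := leP 1 (2 * eps); first by rewrite ler_norml; apply/andP; split; lra.
have Le : 2 * (L * h) <= eps.
  rewrite /eps (_ : 2 * (L * h) = (2 * expR 1) * H%:R * h); last by ring.
  rewrite ler_wpM2r ?(ltW h0) //.
  have n3 : H%:R <= H%:R ^+ 3 :> R by rewrite -[leLHS]expr1 ler_weXn2l.
  by apply: ler_pM => //; lra.
have step a b : 0 < a -> b - a = eps -> eps <= a -> b <= 1 ->
    `|E (fun z => ramp a b (V z)) - ramp_mean a b| <= eps / 4 + k / 4.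
  move=> a0 ba ea b1; apply: le_trans (step_bound a0 _ b1 _ _ _) _; rewrite ?ba //; try lra.
  have -> : bootstrap_const * H%:R ^+ 3 * h = eps / 4 by rewrite /eps; field.
  by rewrite mulrDr mulr1 lerD2l mulrC mulrA divfK ?gt_eqF.
have upper y : eps <= y -> y <= 1 - eps -> F y <= y + 3 / 4 * eps + k / 4.
  move=> y0 y1; have a0 : 0 < y by lra.
  have ab : y < y + eps by lra.
  have ba : y + eps - y = eps by ring.
  have := step y (y + eps) a0 ba y0 _; rewrite /ramp_mean ler_norml => /(_ _)/andP[|_ s]; first lra.
  have : F y <= E (fun z => ramp y (y + eps) (V z)).
    apply: le_mean => z _; case: (leP (V z) y) => vy /=; first by rewrite (ramp_lo ab vy).1.
    by have [v0 v1] := V01 z; have b1 : y + eps <= 1 by [lra]; have [/andP[]] := ramp_bounds a0 ab b1 v0 v1.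
  by lra.
have lower y : 2 * eps <= y -> y <= 1 -> y - 3 / 4 * eps - k / 4 <= F y.
  move=> y0 y1; have a0 : 0 < y - eps by lra.
  have ab : y - eps < y by lra.
  have ba : y - (y - eps) = eps by ring.
  have := step (y - eps) y a0 ba _ y1; rewrite /ramp_mean ler_norml => /(_ _)/andP[|s _]; first lra.
  have : E (fun z => ramp (y - eps) y (V z)) <= F y.
    apply: le_mean => z _; have [v0 v1] := V01 z.
    case: (leP (V z) y) => vy /=; last by rewrite (ramp_hi ab (ltW vy)).1.
    by have [/andP[]] := ramp_bounds a0 ab y1 v0 v1.
  by lra.
rewrite ler_norml; apply/andP; split.
  have [xe|xe] := leP (2 * eps) x; last by lra.
  by have := lower x xe x1; lra.
have [xe|xe] := leP x (1 - eps); last by lra.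
have [xe'|xe'] := leP eps x; first by have := upper x xe' xe; lra.
have := F_le (ltW xe'); have := upper eps (lexx _); lra.
Qed.

End Step.

(** From the trivial distance 1, iterating [k |-> 2 eps + k / 4] preserves the form [3 eps + 4^-n];
    stopping when [4^-n <= eps] leaves [4 eps]. *)
Lemma bootstrap x : 0 <= x <= 1 -> `|F x - x| <= 16 * bootstrap_const * H%:R ^+ 3 * h.
Proof.
have H1 : 1 <= H%:R :> R by rewrite ler1n.
have h0 := h_gt0; have E1 := expR_gt0 (1 : R); have E2 := expR_gt0 (2 : R).
have C0 : 1 <= bootstrap_const by rewrite /bootstrap_const; lra.
pose eps := 4 * bootstrap_const * H%:R ^+ 3 * h.
have eps0 : 0 < eps by rewrite /eps !mulr_gt0 ?exprn_gt0 //; lra.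
have iter n y : 0 <= y <= 1 -> `|F y - y| <= 3 * eps + 4 ^- n.
  elim: n y => [|n IH] y y01.
    have [? ?] := F01 y; rewrite expr0 invr1 ler_norml; apply/andP; split; lra.
  apply: le_trans (bootstrap_step IH y01) _; rewrite -/eps exprSr invfM; lra.
move=> x01; pose n := (Num.trunc eps^-1).+1.
have : 4 ^- n <= eps.
  rewrite invf_ple ?posrE ?exprn_gt0 //; apply: ltW; apply: lt_le_trans (truncnS_gt _) _.
  by rewrite -natrX ler_nat ltnW // ltn_expl.
have := iter n x x01; rewrite /eps; lra.
Qed.

End Bootstrap.

(** * Positive semidefinite forms *)

Section MatrixForm.
Variable R : realType.

Definition mxform n (B : 'M[R]_n) (u v : 'cV[R]_n) : R := (u^T *m B *m v) 0 0.

Lemma mxform_mul m n (A : 'M[R]_(m, n)) (B : 'M[R]_m) (u v : 'cV[R]_n) :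
  mxform (A^T *m B *m A) u v = mxform B (A *m u) (A *m v).
Proof. by rewrite /mxform trmx_mul !mulmxA. Qed.

Lemma mxformB n (A B : 'M[R]_n) (u v : 'cV_n) :
  mxform (A - B) u v = mxform A u v - mxform B u v.
Proof. by rewrite /mxform mulmxBr mulmxBl !mxE. Qed.

Lemma mxformZ n (k : R) (B : 'M[R]_n) (u v : 'cV_n) : mxform (k *: B) u v = k * mxform B u v.
Proof. by rewrite /mxform -scalemxAr -scalemxAl mxE. Qed.

Lemma mxform_diag n (d : 'rV[R]_n) (u v : 'cV_n) :
  mxform (diag_mx d) u v = \sum_q d 0 q * (u q 0 * v q 0).
Proof.
rewrite /mxform mul_mx_diag mxE; apply: eq_bigr => q _; rewrite !mxE; ring.
Qed.

Lemma mxformE n (B : 'M[R]_n) (u v : 'cV_n) :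
  mxform B u v = \sum_q \sum_q' B q q' * (u q 0 * v q' 0).
Proof.
rewrite /mxform mxE exchange_big /=; apply: eq_bigr => q _.
rewrite mxE mulr_suml; apply: eq_bigr => q' _; rewrite !mxE; ring.
Qed.

Lemma mxform1 n (u v : 'cV[R]_n) : mxform 1%:M u v = \sum_q u q 0 * v q 0.
Proof.
rewrite /mxform mulmx1 mxE; by apply: eq_bigr => q _; rewrite mxE.
Qed.

Lemma mxform_inner_product n (B : 'M[R]_n) : B^T = B -> (forall u, 0 <= mxform B u u) ->
  inner_product (mxform B).
Proof.
move=> Bs B0; split => // [u v|u v w|k u v].
- by rewrite /mxform -[in RHS](trmxK (v^T *m B *m u)) [RHS]mxE !trmx_mul trmxK Bs mulmxA.
- by rewrite /mxform linearD /= !mulmxDl mxE.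
- by rewrite /mxform linearZ /= -!scalemxAl mxE.
Qed.

Lemma mxform1_inner_product n : inner_product (mxform (1%:M : 'M[R]_n)).
Proof.
apply: mxform_inner_product; first exact: trmx1.
by move=> u; rewrite mxform1 sumr_ge0 // => q _; rewrite -expr2 sqr_ge0.
Qed.

Lemma mxform_invmx n (B : 'M[R]_n) (u v : 'cV_n) : B^T = B -> B \in unitmx ->
  mxform B (invmx B *m u) v = mxform 1%:M u v.
Proof.
move=> Bs Bu; rewrite /mxform trmx_mul trmx_inv Bs -(mulmxA u^T) mulVmx //.
Qed.

Lemma invmx_form_ge0 n (B : 'M[R]_n) : B^T = B -> B \in unitmx -> (forall u, 0 <= mxform B u u) ->
  forall u, 0 <= mxform (invmx B) u u.
Proof.
move=> Bs Bu B0 u; have := B0 (invmx B *m u); rewrite mxform_invmx //.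
by rewrite /mxform mulmx1 mulmxA.
Qed.

(** For [y = B^-1 u], one has [m |y|^2 <= y.B y = u.y], and the Cauchy-Schwarz inequality bounds
    [(u.y)^2] by [|u|^2 |y|^2]. *)
Lemma invmx_form_le n (B : 'M[R]_n) (m : R) : B^T = B -> B \in unitmx -> 0 < m ->
  (forall u, m * mxform 1%:M u u <= mxform B u u) ->
  forall u, mxform (invmx B) u u <= mxform 1%:M u u / m.
Proof.
move=> Bs Bu m0 Bm u; set y := invmx B *m u.
have e : mxform (invmx B) u u = mxform 1%:M u y by rewrite /mxform mulmx1 mulmxA.
have h1 := Bm y; rewrite mxform_invmx // in h1.
have h2 := cauchy_schwarz (mxform1_inner_product n) u y.
rewrite e; move: h1 h2; have := dot_ge0 (mxform1_inner_product n) u.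
have := dot_ge0 (mxform1_inner_product n) y.
move: (mxform _ u u) (mxform _ y y) (mxform _ u y) => x z t z0 x0 h1 h2.
rewrite ler_pdivlMr //; have [t0|t0] := leP t 0; first by nra.
rewrite -(ler_pM2l t0); nra.
Qed.

Lemma mxform_bound n (B : 'M[R]_n) : exists2 M, 0 < M & forall u, mxform B u u <= M * mxform 1%:M u u.
Proof.
exists (1 + \sum_q \sum_q' `|B q q'|).
  by rewrite ltr_pwDl // sumr_ge0 // => q _; rewrite sumr_ge0.
move=> u; set s := mxform 1%:M u u.
have s0 : 0 <= s := dot_ge0 (mxform1_inner_product n) u.
have us q : u q 0 ^+ 2 <= s.
  rewrite /s mxform1 (bigD1 q) //= -expr2 lerDl sumr_ge0 // => q' _.
  by rewrite -expr2 sqr_ge0.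
apply: (@le_trans _ _ ((\sum_q \sum_q' `|B q q'|) * s)); last by rewrite ler_wpM2r // lerDr.
rewrite mxformE mulr_suml; apply: ler_sum => q _; rewrite mulr_suml; apply: ler_sum => q' _.
apply: le_trans (ler_norm _) _; rewrite normrM ler_wpM2l //.
have := us q; have := us q'; rewrite ler_norml => h1 h2.
have := sqr_ge0 (u q 0 - u q' 0); have := sqr_ge0 (u q 0 + u q' 0).
by move=> h3 h4; apply/andP; split; nra.
Qed.

Lemma rayleigh n (A : 'M[R]_n) (m : R) : (0 < n)%N -> A^T = A ->
  (forall u, 0 <= mxform A u u) -> (forall a, eigenvalue A a -> m <= a) ->
  forall u, m * mxform 1%:M u u <= mxform A u u.
Proof.
case: n A => // n A _ As A0 Aeig.
pose S : set R := [set l | forall u, l * mxform 1%:M u u <= mxform A u u].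
have S0 : S 0 by move=> u; rewrite mul0r.
have e0 : mxform 1%:M (delta_mx 0 0 : 'cV[R]_n.+1) (delta_mx 0 0) = 1.
  rewrite mxform1 (bigD1 0) //= !mxE eqxx mulr1 big1 ?addr0 // => i i0.
  by rewrite !mxE (negbTE i0) mul0r.
have Sub : has_ubound S.
  exists (mxform A (delta_mx 0 0) (delta_mx 0 0)) => l /(_ (delta_mx 0 0)).
  by rewrite e0 mulr1.
have hS : has_sup S by split; [exists 0 | ].
pose l := sup S.
have sqn0 := dot_ge0 (mxform1_inner_product n.+1).
have Sl : S l.
  move=> u; have := sqn0 u; rewrite le_eqVlt => /predU1P[<-|u0]; first by rewrite mulr0.
  rewrite -ler_pdivlMr //; apply: ge_sup; first by exists 0.
  by move=> x /(_ u); rewrite ler_pdivlMr.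
(* If [l] is not an eigenvalue, [A - l] is positive and invertible, so that
   [l] can be increased within [S]. *)
suff ml : m <= l.
  by move=> u; apply: le_trans (Sl u); rewrite ler_wpM2r.
rewrite leNgt; apply/negP => lm.
pose B := A - l%:M.
have Bform u : mxform B u u = mxform A u u - l * mxform 1%:M u u.
  by rewrite /B mxformB -(scalemx1 _ l) mxformZ.
have Bu : B \in unitmx.
  have : ~~ eigenvalue A l by apply/negP => /Aeig; rewrite leNgt lm.
  by rewrite /eigenvalue negbK /eigenspace kermx_eq0 row_free_unit.
have Bs : B^T = B by rewrite /B linearB /= As tr_scalar_mx.
have B0 u : 0 <= mxform B u u by rewrite Bform subr_ge0 Sl.
have [M M0 BM] := mxform_bound (invmx B).
(* The Cauchy-Schwarz inequality for the form [B], applied to [B^-1 u] and [u], gives [|u|^4 <=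
   (u.B^-1 u) (u.B u) <= M |u|^2 (u.B u)]. *)
have lS : S (l + M^-1).
  move=> u; rewrite mulrDl addrC -lerBrDr -Bform mulrC ler_pdivrMr //.
  have := cauchy_schwarz (mxform_inner_product Bs B0) (invmx B *m u) u.
  rewrite !mxform_invmx // (_ : mxform 1%:M u (invmx B *m u) = mxform (invmx B) u u); last first.
    by rewrite /mxform mulmx1 mulmxA.
  have := BM u; have := sqn0 u; have := B0 u.
  move: (mxform B u u) (mxform 1%:M u u) (mxform (invmx B) u u) => x z t x0 z0 h1 h2.
  move: z0; rewrite le_eqVlt => /predU1P[z0|z0]; first by rewrite -z0 mulr_ge0 // ltW.
  rewrite -(ler_pM2l z0); nra.
have : l + M^-1 <= l by exact: ub_le_sup.
by have : 0 < M^-1 by [rewrite invr_gt0]; lra.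
Qed.

End MatrixForm.

Section Nonempty.
Variables (N Q : nat) (Nq : 'I_Q -> nat).

Lemma admissible_nonempty : N = (\sum_q Nq q)%N ->
  (0 < #|[pred Z : {ffun 'I_N -> 'I_Q} | admissible Nq Z]|)%N.
Proof.
move=> NE; pose s := flatten [seq nseq (Nq q) q | q <- enum 'I_Q].
have sz : size s = N.
  rewrite NE size_flatten /shape -map_comp sumnE big_map big_enum /=.
  by apply: eq_bigr => q _; rewrite size_nseq.
have cnt q : count_mem q s = Nq q.
  rewrite count_flatten -map_comp sumnE big_map big_enum /= (bigD1 q) //= count_nseq /= eqxx mul1n.
  rewrite big1 ?addn0 // => q' q'q; rewrite count_nseq /=.
  by rewrite (negbTE q'q).
pose t := Tuple (introT eqP sz).
apply/card_gt0P; exists [ffun i => tnth t i]; rewrite inE; apply/forallP => q.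
rewrite -(cnt q) -[s]/(val t) -[val t]map_tnth_enum count_map -sum1_card -sum1_count big_enum_cond.
by apply/eqP; apply: eq_bigl => i; rewrite !inE ffunE.
Qed.

End Nonempty.

(** * The completely randomized design *)

Section Design.
Variables (R : realType) (N Q H : nat) (Nq : 'I_Q -> nat) (Y : 'I_N -> 'I_Q -> R) (F : 'M[R]_(Q, H)).
Hypothesis Nq_ge1 : forall q, (1 <= Nq q)%N.
Implicit Types (Z : {ffun 'I_N -> 'I_Q}) (i j : 'I_N) (q : 'I_Q) (u v w : 'cV[R]_H).

Let Nq0 q : (Nq q)%:R != 0 :> R. Proof. by rewrite pnatr_eq0 -lt0n. Qed.

Definition unit_effect i q : 'cV[R]_H :=
  ((Nq q)%:R^-1 * (Y i q - Ybar Y q)) *: (row q F)^T.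

Lemma sum_centered q : \sum_i (Y i q - Ybar Y q) = 0.
Proof.
rewrite sumrB sumr_const card_ord /Ybar -[_ *+ N]mulr_natl mulrA.
case: (posnP N) => [N0|N0].
  by rewrite !big1 ?mulr0 ?subr0 // => i _; have := ltn_ord i; rewrite {2}N0.
by rewrite mulfV ?mul1r ?subrr // pnatr_eq0 -lt0n.
Qed.

Lemma sum_unit_effect q : \sum_i unit_effect i q = 0.
Proof. by rewrite -scaler_suml -mulr_sumr sum_centered mulr0 scale0r. Qed.

Lemma assigned_sum_unit_effect Z : admissible Nq Z ->
  assigned_sum unit_effect Z = gammahat Nq Y F Z - gamma Y F.
Proof.
move=> /forallP aZ; apply/colP => a.
rewrite /gammahat /gamma -mulmxBr mxE /assigned_sum summxE (partition_big Z xpredT) //=.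
apply: eq_bigr => q _; rewrite !mxE.
rewrite (eq_bigr (fun i => F q a * (Nq q)%:R^-1 * (Y i q - Ybar Y q))); last first.
  by move=> i /eqP ->; rewrite !mxE; ring.
rewrite -mulr_sumr sumrB sumr_const -[_ *+ _]mulr_natl.
rewrite (_ : #|_| = Nq q); last by rewrite -(eqP (aZ q)); apply: eq_card => i; rewrite !inE.
by rewrite mulrBr mulrBr; field.
Qed.

Lemma VYhat_sym : (VYhat Nq Y)^T = VYhat Nq Y.
Proof.
rewrite /VYhat linearB /= tr_diag_mx linearZ /=; congr (_ - _ *: _).
apply/matrixP => q q'; rewrite !mxE /Scov; congr (_ * _).
by apply: eq_bigr => i _; rewrite mulrC.
Qed.

Lemma Vgammahat_sym : (Vgammahat Nq Y F)^T = Vgammahat Nq Y F.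
Proof. by rewrite /Vgammahat !trmx_mul trmxK VYhat_sym mulmxA. Qed.

Hypothesis N_gt1 : (1 < N)%N.

Lemma VYhat_form (f g : 'cV[R]_Q) :
  (N%:R - 1) * mxform (VYhat Nq Y) f g
  = \sum_i \sum_q (Nq q)%:R^-1 * (Y i q - Ybar Y q) ^+ 2 * (f q 0 * g q 0)
    - N%:R^-1 * \sum_i (\sum_q (Y i q - Ybar Y q) * f q 0) * (\sum_q (Y i q - Ybar Y q) * g q 0).
Proof.
have n1 : N%:R - 1 = N.-1%:R :> R.
  by case: (N) N_gt1 => // n _; rewrite -natr1 addrK.
have n0 : N.-1%:R != 0 :> R by rewrite pnatr_eq0 -lt0n -ltnS prednK // ltnW.
rewrite /VYhat mxformB mxformZ mxform_diag mxformE mulrBr n1; congr (_ - _).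
  rewrite exchange_big mulr_sumr; apply: eq_bigr => q _; rewrite mxE /Scov.
  rewrite [RHS](eq_bigr (fun i => (Nq q)%:R^-1 * (f q 0 * g q 0)
      * ((Y i q - Ybar Y q) * (Y i q - Ybar Y q)))); last first.
    by move=> i _; ring.
  by rewrite -mulr_sumr; field; rewrite n0 Nq0.
rewrite mulrCA; congr (_ * _).
transitivity (\sum_q \sum_q' \sum_i ((Y i q - Ybar Y q) * f q 0) * ((Y i q' - Ybar Y q') * g q' 0)).
  rewrite mulr_sumr; apply: eq_bigr => q _; rewrite mulr_sumr; apply: eq_bigr => q' _.
  rewrite mxE /Scov -mulrA mulVKf // mulr_suml; apply: eq_bigr => i _; ring.
under eq_bigr => q _ do rewrite exchange_big /=.
rewrite exchange_big /=; apply: eq_bigr => i _.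
by rewrite mulr_suml; apply: eq_bigr => q _; rewrite mulr_sumr.
Qed.

Lemma sum_diff_prod (I : finType) (x y : I -> R) :
  \sum_i \sum_j (x i - x j) * (y i - y j)
  = 2 * (#|I|%:R * \sum_i x i * y i - (\sum_i x i) * (\sum_i y i)).
Proof.
have e (i : I) : \sum_j (x i - x j) * (y i - y j)
   = #|I|%:R * (x i * y i) + \sum_j x j * y j - x i * \sum_j y j - (\sum_j x j) * y i.
  rewrite mulr_sumr mulr_suml.
  rewrite (eq_bigr (fun j : I => x i * y i + x j * y j - x i * y j - x j * y i)); last by move=> j _; ring.
  by rewrite !sumrB big_split /= sumr_const -[_ *+ _]mulr_natl.
under eq_bigr => i _ do rewrite e.
rewrite !sumrB big_split /= sumr_const -!mulr_suml -!mulr_sumr -[_ *+ _]mulr_natl; ring.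
Qed.

Hypothesis V_unit : Vgammahat Nq Y F \in unitmx.
Hypothesis V_ge0 : forall u, 0 <= mxform (Vgammahat Nq Y F) u u.
Local Notation dot := (mxform (invmx (Vgammahat Nq Y F))).

Lemma dot_ip : inner_product dot.
Proof.
apply: mxform_inner_product; first by rewrite trmx_inv Vgammahat_sym.
exact: invmx_form_ge0 Vgammahat_sym V_unit V_ge0.
Qed.

Let c : R := 4 * N%:R * (N%:R * (N%:R - 1)).

(** Summing over [i] and [j] first, the centring removes the product of the sums. Summing over [k]
    and [l] then leaves sums over labels weighted by [Nq], the same for every admissible [Z]. The
    result is the form of [VYhat] at [f v], [f w], and [f x = F V^-1 x] turns it into [dot v w]. *)
Lemma swap_covariance Z v w : admissible Nq Z ->
  sum4 (fun i j k l => dot (swap_diff unit_effect i j (Z k) (Z l)) v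
                     * dot (swap_diff unit_effect i j (Z k) (Z l)) w) = c * dot v w.
Proof.
move=> aZ.
have N0 : N%:R != 0 :> R by rewrite pnatr_eq0 -lt0n ltnW.
pose be (x : 'cV[R]_H) i q := dot (unit_effect i q) x.
have be0 x q : \sum_i be x i q = 0.
  by rewrite -(dot_suml dot_ip) sum_unit_effect (dot0l dot_ip).
pose f (x : 'cV[R]_H) : 'cV[R]_Q := F *m (invmx (Vgammahat Nq Y F) *m x).
have beE x i q : be x i q = (Nq q)%:R^-1 * ((Y i q - Ybar Y q) * f x q 0).
  rewrite /be /unit_effect (dotZl dot_ip) -mulrA; congr (_ * (_ * _)).
  by rewrite /mxform trmxK /f -mulmxA -row_mul mxE.
have dE i j k l x : dot (swap_diff unit_effect i j (Z k) (Z l)) x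
   = (be x i (Z l) - be x i (Z k)) - (be x j (Z l) - be x j (Z k)).
  by rewrite /swap_diff !(dotBl dot_ip, dotDl dot_ip) /be; ring.
transitivity (\sum_k \sum_l \sum_i \sum_j
   ((be v i (Z l) - be v i (Z k)) - (be v j (Z l) - be v j (Z k)))
   * ((be w i (Z l) - be w i (Z k)) - (be w j (Z l) - be w j (Z k)))).
  rewrite /sum4; under eq_bigr => i _ do rewrite exchange_big /=.
  rewrite exchange_big /=; apply: eq_bigr => k _.
  under eq_bigr => i _ do rewrite exchange_big /=.
  rewrite exchange_big /=; apply: eq_bigr => l _.
  by apply: eq_bigr => i _; apply: eq_bigr => j _; rewrite !dE.
have e1 k l : \sum_i \sum_j
   ((be v i (Z l) - be v i (Z k)) - (be v j (Z l) - be v j (Z k)))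
   * ((be w i (Z l) - be w i (Z k)) - (be w j (Z l) - be w j (Z k)))
   = 2 * N%:R * \sum_i (be v i (Z l) - be v i (Z k)) * (be w i (Z l) - be w i (Z k)).
  rewrite sum_diff_prod card_ord sumrB !be0 subrr mul0r subr0; ring.
under eq_bigr => k _ do under eq_bigr => l _ do rewrite e1.
under eq_bigr => k _ do rewrite -mulr_sumr exchange_big /=.
rewrite -mulr_sumr exchange_big /=.
have e2 i : \sum_k \sum_l (be v i (Z l) - be v i (Z k)) * (be w i (Z l) - be w i (Z k))
  = 2 * (N%:R * \sum_k be v i (Z k) * be w i (Z k) - (\sum_k be v i (Z k)) * (\sum_k be w i (Z k))).
  by rewrite exchange_big /= sum_diff_prod card_ord.
under eq_bigr => i _ do rewrite e2 (sum_admissible (fun q => be v i q * be w i q) aZ)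
  (sum_admissible (be v i) aZ) (sum_admissible (be w i) aZ).
rewrite -mulr_sumr sumrB -mulr_sumr.
have -> : dot v w = mxform (VYhat Nq Y) (f v) (f w).
  rewrite /f -mxform_mul -/(Vgammahat _ _ _) mxform_invmx ?Vgammahat_sym //.
  by rewrite /mxform mulmx1 mulmxA.
have -> : \sum_i \sum_q (Nq q)%:R * (be v i q * be w i q)
    = \sum_i \sum_q (Nq q)%:R^-1 * (Y i q - Ybar Y q) ^+ 2 * (f v q 0 * f w q 0).
  apply: eq_bigr => i _; apply: eq_bigr => q _; rewrite !beE; field; exact: Nq0.
have s x i : \sum_q (Nq q)%:R * be x i q = \sum_q (Y i q - Ybar Y q) * f x q 0.
  by apply: eq_bigr => q _; rewrite beE mulVKf.
under [X in _ * (_ * (_ - X))]eq_bigr => i _ do rewrite !s.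
have := VYhat_form (f v) (f w).
set A := \sum_i _; set B := \sum_i _; set G := mxform _ _ _ => e.
rewrite /c (_ : _ * G = 4 * N%:R * N%:R * ((N%:R - 1) * G)); last by ring.
by rewrite e; field.
Qed.

Lemma swap_variance Z v : admissible Nq Z ->
  sum4 (fun i j k l => dot (swap_diff unit_effect i j (Z k) (Z l)) v ^+ 2) = c * dot v v.
Proof. by move=> aZ; rewrite -(swap_covariance v v aZ); apply: eq_sum4 => i j k l; rewrite expr2. Qed.

Lemma swap_trace Z : admissible Nq Z ->
  sum4 (fun i j k l => dot (swap_diff unit_effect i j (Z k) (Z l))
                           (swap_diff unit_effect i j (Z k) (Z l))) = c * H%:R.
Proof.
move=> aZ; set V := Vgammahat Nq Y F.
(* Expands [dot d d] in the dual bases [V *m e a] and [e a]. *)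
pose e (a : 'I_H) : 'cV[R]_H := delta_mx a 0.
have dotE (d : 'cV[R]_H) : dot d d = \sum_a dot d (V *m e a) * dot d (e a).
  rewrite {1}/mxform -mulmxA mxE; apply: eq_bigr => a _; congr (_ * _).
    by rewrite /mxform -/V mulmxA mulmxKV // -colE !mxE.
  by rewrite (dotC dot_ip) /mxform -/V /e trmx_delta -mulmxA -rowE !mxE.
transitivity (\sum_a sum4 (fun i j k l => dot (swap_diff unit_effect i j (Z k) (Z l)) (V *m e a)
                     * dot (swap_diff unit_effect i j (Z k) (Z l)) (e a))).
  by rewrite sum4_exchange; apply: eq_sum4 => i j k l; exact: dotE.
rewrite (eq_bigr (fun=> c)); first by rewrite sumr_const card_ord mulr_natr.
move=> a _; rewrite (swap_covariance _ _ aZ) -[RHS]mulr1; congr (_ * _).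
rewrite /mxform trmx_mul Vgammahat_sym mulmxK // /e trmx_delta -rowE mxE mxE !eqxx //.
Qed.

End Design.

(** * Smallest eigenvalue of the covariance and size of the summands *)

Section CovarianceBound.
Variables (R : realType) (N Q H : nat) (Nq : 'I_Q -> nat) (Y : 'I_N -> 'I_Q -> R) (F : 'M[R]_(Q, H)).
Variables (c c' nb sigmaF s : R) (QS : {set 'I_Q}).
Hypothesis Nq_ge1 : forall q, (1 <= Nq q)%N.
Hypothesis nb_ge : forall q, q \in QS -> (Nq q)%:R <= nb.
Hypothesis sigma_ge1 : 1 <= sigmaF.
Hypothesis loew : loewner_le (F^T *m diag_mx (\row_q ((Nq q)%:R^-1 * Scov Y q q)) *m F)
               (sigmaF ^+ 2 *: Vgammahat Nq Y F).
Hypothesis F_sup : mx_supnorm F <= c / Q%:R.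
Hypothesis F_eig : forall a, eigenvalue (F^T *m F) a -> c' / Q%:R <= a.
Hypothesis large : 2%:R * (c ^+ 2 / c') * H%:R * #|~: QS|%:R <= Q%:R.
Hypothesis (c_gt0 : 0 < c) (c'_gt0 : 0 < c') (nb_gt0 : 0 < nb) (s_gt0 : 0 < s).
Hypothesis s_le : forall q, q \in QS -> s <= Scov Y q q.
Hypothesis Scov_gt0 : forall q, 0 < Scov Y q q.
Hypothesis (Q_gt0 : (0 < Q)%N) (H_gt0 : (0 < H)%N).
Implicit Types (u : 'cV[R]_H) (q : 'I_Q).
Local Notation V := (Vgammahat Nq Y F).

Let Qr : 0 < Q%:R :> R. Proof. by rewrite ltr0n. Qed.
Let sg : 0 < sigmaF ^+ 2. Proof. by rewrite exprn_gt0 // (lt_le_trans ltr01). Qed.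

Let loew_form u : \sum_q (Nq q)%:R^-1 * Scov Y q q * (F *m u) q 0 ^+ 2 <= sigmaF ^+ 2 * mxform V u u.
Proof.
have := loew u; rewrite -/(mxform _ u u) mxformB mxformZ subr_ge0; apply: le_trans.
by rewrite mxform_mul mxform_diag; apply: ler_sum => q _; rewrite [X in _ <= X * _]mxE expr2.
Qed.

Lemma Vgammahat_ge0 u : 0 <= mxform V u u.
Proof.
rewrite -(pmulr_rge0 _ sg); apply: le_trans (loew_form u).
apply: sumr_ge0 => q _; rewrite mulr_ge0 ?sqr_ge0 // mulr_ge0 ?invr_ge0 //.
exact: ltW.
Qed.

Lemma F_entry_le q a : `|F q a| <= c / Q%:R.
Proof.
apply: le_trans F_sup; rewrite /mx_supnorm.
apply: le_trans (le_bigmax _ (fun i => \big[Num.max/0]_(j < H) `|F i j|) q).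
exact: (le_bigmax _ (fun j => `|F q j|) a).
Qed.

Lemma F_row_le q : mxform 1%:M (row q F)^T (row q F)^T <= H%:R * (c / Q%:R) ^+ 2.
Proof.
rewrite mxform1 (le_trans (y := \sum_(a < H) (c / Q%:R) ^+ 2)) //; last first.
  by rewrite sumr_const card_ord mulr_natl.
apply: ler_sum => a _; rewrite !mxE -expr2 -real_normK ?num_real //.
by rewrite ler_sqr ?nnegrE ?F_entry_le // divr_ge0 // ltW.
Qed.

(** [F_eig] bounds the sum of all [(F u)_q^2] from below. Rows outside [QS] account for at most half
    of that bound: each is at most [H (c / Q)^2 |u|^2], and [large] limits their number. In [QS] the
    weights [S / N_q] are at least [s / nb], and [loew] carries the estimate over to [V]. *)
Lemma Vgammahat_lower u : s * c' / (2 * nb * sigmaF ^+ 2 * Q%:R) * mxform 1%:M u u <= mxform V u u.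
Proof.
set x := mxform 1%:M u u.
have x0 : 0 <= x := dot_ge0 (mxform1_inner_product R H) u.
have FF : c' / Q%:R * x <= \sum_q (F *m u) q 0 ^+ 2.
  have fs : (F^T *m F)^T = F^T *m F by rewrite trmx_mul trmxK.
  have e v : mxform (F^T *m F) v v = \sum_q (F *m v) q 0 ^+ 2.
    have := mxform_mul F 1%:M v v; rewrite mulmx1 mxform1 => ->.
    by apply: eq_bigr => q _; rewrite expr2.
  rewrite -e; apply: rayleigh => // v; rewrite e sumr_ge0 // => q _; exact: sqr_ge0.
have row_le q : (F *m u) q 0 ^+ 2 <= H%:R * (c / Q%:R) ^+ 2 * x.
  have -> : (F *m u) q 0 = mxform 1%:M (row q F)^T u.
    by rewrite mxform1 mxE; apply: eq_bigr => a _; rewrite !mxE.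
  apply: le_trans (cauchy_schwarz (mxform1_inner_product R H) _ _) _.
  by rewrite ler_wpM2r // F_row_le.
have split : \sum_q (F *m u) q 0 ^+ 2 <= \sum_(q in QS) (F *m u) q 0 ^+ 2 + c' / Q%:R / 2 * x.
  rewrite (bigID (mem QS)) /= lerD2l.
  apply: (@le_trans _ _ (\sum_(q in ~: QS) H%:R * (c / Q%:R) ^+ 2 * x)).
    rewrite [leRHS](eq_bigl (fun q => q \notin QS)); last by move=> q; rewrite inE.
    by apply: ler_sum => q _; exact: row_le.
  rewrite sumr_const -[leLHS]mulr_natr mulrAC ler_wpM2r //.
  rewrite (_ : H%:R * (c / Q%:R) ^+ 2 * _ =
     (2 * (c ^+ 2 / c') * H%:R * #|~: QS|%:R) * (c' / Q%:R ^+ 2 / 2)); last first.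
    by field; rewrite !gt_eqF.
  rewrite (_ : c' / Q%:R / 2 = Q%:R * (c' / Q%:R ^+ 2 / 2)); last by field; rewrite gt_eqF.
  by rewrite ler_wpM2r // !mulr_ge0 ?invr_ge0 ?exprn_ge0 // ltW.
have key : s / nb * (c' / Q%:R / 2 * x) <= sigmaF ^+ 2 * mxform V u u.
  apply: le_trans (loew_form u).
  apply: (@le_trans _ _ (\sum_(q in QS) s / nb * (F *m u) q 0 ^+ 2)).
    rewrite -mulr_sumr ler_wpM2l //; first by rewrite divr_ge0 // ltW.
    by move: FF split; lra.
  rewrite [leRHS](bigID (mem QS)) /= -[leLHS]addr0 lerD //.
    apply: ler_sum => q qS; rewrite ler_wpM2r ?sqr_ge0 //.
    rewrite mulrC ler_pM ?invr_ge0 ?s_le ?(ltW s_gt0) ?(ltW nb_gt0) //.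
    by rewrite lef_pV2 ?posrE ?nb_ge // ltr0n.
  by apply: sumr_ge0 => q _; rewrite mulr_ge0 ?sqr_ge0 // mulr_ge0 ?invr_ge0 // ltW.
rewrite -(ler_pM2l sg); apply: le_trans key; rewrite le_eqVlt; apply/orP; left; apply/eqP.
by field; rewrite !gt_eqF // (lt_le_trans ltr01).
Qed.

(** Dividing the squared length of a row, of order [H / Q^2], by the eigenvalue bound, of order
    [s / Q], gives [H / (s Q)], and [N <= K Q] converts [Q] into [N]. The factor [1 / N_q] is simply
    bounded by 1. *)
Lemma unit_effect_le (K M : R) i q : 0 < K -> N%:R <= K * Q%:R -> (0 < N)%N ->
  V \in unitmx -> (forall i q, `|Y i q - Ybar Y q| <= M) ->
  nrm (mxform (invmx V)) (unit_effect Nq Y F i q)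
  <= Num.sqrt (2 * c ^+ 2 * nb * sigmaF ^+ 2 * K / c') * (M / Num.sqrt s) * (Num.sqrt H%:R / Num.sqrt N%:R).
Proof.
move=> K0 NK N0 Vu YM; have ip := dot_ip Vu Vgammahat_ge0.
have M0 : 0 <= M by apply: le_trans (YM i q).
have Nr : 0 < N%:R :> R by rewrite ltr0n.
rewrite /unit_effect (nrmZ ip).
have sg0 : 0 < sigmaF := lt_le_trans ltr01 sigma_ge1.
have v0 : 0 < s * c' / (2 * nb * sigmaF ^+ 2 * Q%:R) by rewrite divr_gt0 // !mulr_gt0.
have h1 := invmx_form_le (Vgammahat_sym Nq Y F) Vu v0 Vgammahat_lower (row q F)^T.
have h2 := F_row_le q.
apply: (@le_trans _ _ (M * Num.sqrt (2 * c ^+ 2 * nb * sigmaF ^+ 2 * K / c' * (H%:R / (s * N%:R))))).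
  apply: ler_pM => //; first exact: nrm_ge0.
    rewrite normrM ger0_norm ?invr_ge0 //; apply: le_trans (_ : 1 * M <= _); last by rewrite mul1r.
    by apply: ler_pM; rewrite ?invr_ge0 // invf_le1 ?ler1n // ltr0n.
  apply: ler_wsqrtr; apply: le_trans h1 _; rewrite ler_pdivrMr //; apply: le_trans h2 _.
  rewrite (_ : _ * (s * c' / _) = (K * Q%:R / N%:R) * (H%:R * (c / Q%:R) ^+ 2)); last first.
    by field; rewrite !gt_eqF // (lt_le_trans ltr01).
  rewrite -[leLHS]mul1r ler_wpM2r //; last by rewrite ler_pdivlMr // mul1r.
  by rewrite mulr_ge0 // sqr_ge0.
have p0 : 0 <= 2 * c ^+ 2 * nb * sigmaF ^+ 2 * K / c'.
  by rewrite divr_ge0 ?(ltW c'_gt0) // !mulr_ge0 ?sqr_ge0 // ltW.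
rewrite (sqrtrM _ p0) (sqrtrM _ (ler0n _ H)) sqrtrV ?mulr_ge0 ?(ltW s_gt0) // (sqrtrM _ (ltW s_gt0)).
rewrite le_eqVlt; apply/orP; left; apply/eqP; field.
by rewrite !gt_eqF // sqrtr_gt0.
Qed.

End CovarianceBound.

(** * Kolmogorov distance in terms of the largest summand *)

Section NormalizedBound.
Variables (R : realType) (N Q H : nat) (Nq : 'I_Q -> nat) (Y : 'I_N -> 'I_Q -> R) (F : 'M[R]_(Q, H)).
Hypothesis Nq_ge1 : forall q, (1 <= Nq q)%N.
Hypothesis NE : N = (\sum_q Nq q)%N.
Hypothesis (N_gt1 : (1 < N)%N) (H_gt0 : (0 < H)%N).
Hypothesis V_unit : Vgammahat Nq Y F \in unitmx.
Hypothesis V_ge0 : forall u, 0 <= mxform (Vgammahat Nq Y F) u u.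
Local Notation dot := (mxform (invmx (Vgammahat Nq Y F))).
Local Notation al := (unit_effect Nq Y F).
Local Notation A := [pred Z : {ffun 'I_N -> 'I_Q} | admissible Nq Z].
Let ip := dot_ip V_unit V_ge0.

Lemma TstatE Z : admissible Nq Z -> Tstat Nq Y F Z = nrm dot (assigned_sum al Z) ^+ 2.
Proof. by move=> aZ; rewrite (nrm_sqr ip) assigned_sum_unit_effect. Qed.

Lemma prob_T_leE t : prob_T_le Nq Y F t = mean A (fun Z => (Tstat Nq Y F Z <= t)%R%:R).
Proof.
rewrite /prob_T_le /mean; congr (_ / _).
  rewrite -sum1_card natr_sum (eq_bigl (fun Z => (Z \in A) && (Tstat Nq Y F Z <= t))); last first.
    by move=> Z; rewrite !inE.
  by rewrite big_mkcondr; apply: eq_bigr => Z _; case: ifP.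
by congr (_%:R); apply: eq_card => Z; rewrite !inE.
Qed.

Let An : (0 < #|A|)%N := admissible_nonempty NE.

Lemma prob_T_le01 t : 0 <= prob_T_le Nq Y F t <= 1.
Proof.
rewrite prob_T_leE; apply/andP; split; first exact: mean_ge0.
by rewrite -[leRHS](mean_cst An); apply: le_mean => Z _; rewrite lern1 leq_b1.
Qed.

Lemma prob_T_le_bound (delta t : R) : 0 < delta -> (forall i q, nrm dot (al i q) <= delta) ->
  `|prob_T_le Nq Y F t - chi2_cdf H t| <= 16 * bootstrap_const R * H%:R ^+ 3 * (12 * delta).
Proof.
move=> d0 al_le; have p01 := prob_T_le01 t.
have c0 := chi2_cdf_ge0 t H_gt0; have c1 := chi2_cdf_le1 t H_gt0.
have B1 : 1 <= bootstrap_const R.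
  rewrite /bootstrap_const; have := expR_gt0 (1 : R); have := expR_gt0 (2 : R); lra.
have H1 : 1 <= H%:R ^+ 3 :> R by rewrite exprn_ege1 // ler1n.
have pos : 0 <= 16 * bootstrap_const R * H%:R ^+ 3 * (12 * delta).
  by rewrite !mulr_ge0 //; lra.
(* If [12 delta > 1] the claimed bound exceeds 1, so the smallness condition of [stein_bound] may be
   assumed. *)
have [d1|d1] := leP (12 * delta) 1; last first.
  apply: (@le_trans _ _ 1); first by rewrite ler_norml; apply/andP; split; lra.
  have : 1 <= bootstrap_const R * H%:R ^+ 3 by rewrite -[leLHS]mulr1 ler_pM.
  by rewrite -(mulrA 16); nra.
have [t0|t0] := ltP t 0.
  rewrite (chi2_cdf_le0 H (ltW t0)) subr0 prob_T_leE (eq_mean (g := fun=> 0)) ?mean_cst ?normr0 //.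
  by move=> Z aZ; rewrite TstatE // leNgt (lt_le_trans t0) // sqr_ge0.
have tr := fun Z (aZ : admissible Nq Z) => swap_trace Nq_ge1 N_gt1 V_unit V_ge0 aZ.
have cv := fun Z (aZ : admissible Nq Z) v => swap_variance Nq_ge1 N_gt1 V_unit V_ge0 v aZ.
have A0 : 0 < #|A|%:R :> R by rewrite ltr0n.
have r2 : mean A (fun Z => nrm dot (assigned_sum al Z) ^+ 2) = H%:R.
  have := second_moment ip (sum_unit_effect Nq Y F) al_le tr erefl N_gt1.
  rewrite sumr_const => e; rewrite /mean (eq_bigr (fun Z => dot (assigned_sum al Z) (assigned_sum al Z))).
    by rewrite e mulfK // gt_eqF.
  by move=> Z _; rewrite (nrm_sqr ip).
have st (a b : R) : 0 < a -> a < b -> b <= 1 -> expR 1 * H%:R * (12 * delta) <= a / 2 ->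
  `|mean A (fun Z => ramp a b (chi2_cdf H (nrm dot (assigned_sum al Z) ^+ 2))) - ramp_mean a b|
  <= H%:R * mean A (fun Z => stein_lip H a b (12 * delta) (nrm dot (assigned_sum al Z))).
  move=> a0 ab b1 La.
  have := stein_bound ip (sum_unit_effect Nq Y F) al_le tr erefl N_gt1 H_gt0 a0 ab b1 cv d1 La => sb.
  rewrite -(mean_cst An (ramp_mean a b)) -meanB /mean normrM [`|_^-1|]ger0_norm ?invr_ge0 ?(ltW A0) //.
  rewrite mulrA ler_pM2r ?invr_gt0 //; apply: le_trans sb; rewrite le_eqVlt; apply/orP; left; apply/eqP.
  by congr `|_|; apply: eq_bigr => Z _; rewrite (nrm_sqr ip).
have h0 : 0 < 12 * delta by rewrite mulr_gt0.
have Pt : 0 <= chi2_cdf H t <= 1 by rewrite c0 c1.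
have := bootstrap An H_gt0 r2 h0 st Pt.
rewrite (eq_mean (g := fun Z => (Tstat Nq Y F Z <= t)%R%:R)) -?prob_T_leE //.
(* [P] is strictly increasing on positive arguments, so the events [T <= t] and [P T <= P t]
   coincide; [t = 0] is separate. *)
move=> Z aZ; rewrite TstatE //; congr (nat_of_bool _)%:R.
set T := _ ^+ 2; apply/idP/idP => [h|]; last exact: le_chi2_cdf.
rewrite leNgt; apply/negP => tT; move: h; rewrite leNgt => /negP; apply.
move: t0; rewrite le_eqVlt => /predU1P[t0|t0]; last exact: chi2_cdf_lt.
by rewrite -t0 (chi2_cdf_le0 H (lexx 0)) chi2_cdf_gt0 // t0.
Qed.

End NormalizedBound.

(** * Comparison of the variances with the largest deviation *)

Section MinScov.
Variables (R : realType) (N Q : nat) (Y : 'I_N -> 'I_Q -> R) (QS : {set 'I_Q}).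
Hypothesis Scov_gt0 : forall q, 0 < Scov Y q q.
Hypothesis Q_gt0 : (0 < Q)%N.
Let s := min_over QS (fun q => Scov Y q q).
Let M := \big[Num.max/0]_q MN Y q.

Lemma N_gt1_of_Scov : (1 < N)%N.
Proof.
case: Q Y Q_gt0 Scov_gt0 => // Q' Y' _ h; have := h ord0; rewrite /Scov.
case: N Y' {h} => [|[|n]] Y' //; by rewrite invr0 mul0r ltxx.
Qed.

Lemma min_Scov_gt0 : 0 < s.
Proof.
rewrite /s /min_over; apply/bigmin_gtP; split=> //.
case: Q Y Q_gt0 Scov_gt0 => // Q' Y' _ h; apply: lt_le_trans (h ord0) _.
exact: (le_bigmax _ (fun q => Scov Y' q q)).
Qed.

Lemma min_Scov_le q : q \in QS -> s <= Scov Y q q.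
Proof. exact: bigmin_le_cond. Qed.

Lemma centered_le i q : `|Y i q - Ybar Y q| <= M.
Proof.
apply: le_trans (le_bigmax _ (MN Y) q).
exact: (le_bigmax _ (fun i => `|Y i q - Ybar Y q|)).
Qed.

Lemma Scov_le q : Scov Y q q <= 2 * M ^+ 2.
Proof.
have N1 := N_gt1_of_Scov.
have N2 : 0 < N.-1%:R :> R by rewrite ltr0n -ltnS prednK // ltnW.
rewrite /Scov mulrC ler_pdivrMr //.
apply: (@le_trans _ _ (\sum_(i < N) M ^+ 2)).
  apply: ler_sum => i _; rewrite -expr2 -real_normK ?num_real // ler_sqr ?nnegrE ?centered_le //.
  exact: le_trans (centered_le i q).
rewrite sumr_const card_ord -[leLHS]mulr_natl [leRHS]mulrAC ler_wpM2r ?sqr_ge0 //.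
rewrite -natrM ler_nat; case: (N) N1 => [|[|n]] // _.
by rewrite /= mul2n -addnn addnS ltnS leq_addr.
Qed.

(** Going through the default value of the minimum covers an empty [QS]. The inequality bounds
    [M / sqrt s] from below, which is what allows its first power to be replaced by its cube. *)
Lemma min_Scov_le_M : s <= 2 * M ^+ 2.
Proof.
apply: le_trans (bigmin_le_id _ _ _ _) _; rewrite /max_all.
apply/bigmax_leP; split; first by rewrite mulr_ge0 // sqr_ge0.
by move=> q _; exact: Scov_le.
Qed.

Lemma max_MN_cube : M ^+ 3 <= \big[Num.max/0]_q MN Y q ^+ 3.
Proof.
case: Q Y Q_gt0 @M => // Q' Y' _ M0.
have [q0 _ e] := @eq_bigmax _ _ _ 0 ord0 xpredT (MN Y') isT (fun q _ => bigmax_ge_id _ _ _ _).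
rewrite /M0 e; exact: (le_bigmax _ (fun q => MN Y' q ^+ 3)).
Qed.

End MinScov.

Theorem theorem8 (R : realType) (c c' : R) (nbar : nat) (cl sigmaF K : R) :
  0 < c -> 0 < c' -> 0 < cl -> 1 <= sigmaF -> 0 < K ->
  exists C : R, 0 < C /\
  forall (cu : R) (N Q H : nat) (Nq : 'I_Q -> nat) (Y : 'I_N -> 'I_Q -> R)
         (F : 'M[R]_(Q, H)) (QS : {set 'I_Q}),
    (* design *)
    (forall q, (1 <= Nq q)%N) ->
    N = (\sum_q Nq q)%N ->
    cl <= cu ->
    (exists N0 : nat, (0 < N0)%N /\
       forall q, q \in ~: QS ->
         exists cq : R, cl <= cq /\ cq <= cu /\ (Nq q)%:R = cq * N0%:R) ->
    (forall q, q \in QS -> (Nq q <= nbar)%N) ->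
    (0 < H)%N ->
    Vgammahat Nq Y F \in unitmx ->
    (* Condition 1 *)
    loewner_le (F^T *m diag_mx (\row_q ((Nq q)%:R^-1 * Scov Y q q)) *m F)
               (sigmaF ^+ 2 *: Vgammahat Nq Y F) ->
    (* Condition 2 *)
    mx_supnorm F <= c / Q%:R ->
    (forall a, eigenvalue (F^T *m F) a -> c' / Q%:R <= a) ->
    2%:R * (c ^+ 2 / c') * H%:R * #|~: QS|%:R <= Q%:R ->
    N%:R <= K * Q%:R ->
    (forall q, 0 < Scov Y q q) ->
    forall t : R,
      `| prob_T_le Nq Y F t - chi2_cdf H t |
        <= C * ((\big[Num.max/0]_q MN Y q ^+ 3)
                 / (min_over QS (fun q => Scov Y q q)) `^ (3%:R / 2))
             * (H%:R `^ (19%:R / 4) / Num.sqrt N%:R).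
Proof.
move=> c0 c'0 _ sg1 K0.
(* [nbar] may be [0] when [QS] is empty. *)
pose nb : R := nbar%:R + 1.
have nb0 : 0 < nb by rewrite ltr_wpDl.
pose D : R := 2 * c ^+ 2 * nb * sigmaF ^+ 2 * K / c'.
have D0 : 0 < D by rewrite divr_gt0 // !mulr_gt0 ?exprn_gt0 // (lt_le_trans ltr01).
have B0 : 0 < bootstrap_const R.
  by rewrite /bootstrap_const; have := expR_gt0 (1 : R); have := expR_gt0 (2 : R); lra.
(* 384 is 16 * 12 from [prob_T_le_bound], times 2 from [b <= 2 b^3] for [b = M / sqrt s]. *)
exists (384 * bootstrap_const R * Num.sqrt D); split.
  by apply: mulr_gt0; [apply: mulr_gt0; [rewrite ltr0n | exact: B0] | rewrite sqrtr_gt0; exact: D0].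
move=> cu N Q H Nq Y F QS Nq1 NE _ _ Nqb H0 Vu loew Fsup Feig large NK S0 t.
(* Without groups the covariance would be the zero matrix of positive size, which is singular. *)
have Q0 : (0 < Q)%N.
  rewrite lt0n; apply/eqP => Q0; move: Vu; rewrite /Vgammahat.
  have -> : F = 0 by apply/matrixP => q; have := ltn_ord q; rewrite {2}Q0.
  rewrite mulmx0; case: (H) H0 => // n _.
  by rewrite unitmxE det0 unitr0.
have N1 := N_gt1_of_Scov S0 Q0; have N0 := ltnW N1.
pose s := min_over QS (fun q => Scov Y q q); pose M := \big[Num.max/0]_q MN Y q.
have s0 : 0 < s := min_Scov_gt0 QS S0 Q0.
have sM : s <= 2 * M ^+ 2 := min_Scov_le_M QS S0 Q0.
have M0 : 0 < M.
  rewrite lt_neqAle bigmax_ge_id andbT; apply/eqP => M0.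
  by move: sM; rewrite -M0 expr0n /= mulr0 leNgt s0.
have nbq q : q \in QS -> (Nq q)%:R <= nb.
  by move=> /Nqb h; rewrite /nb -[leLHS]addr0 lerD // ler_nat.
have V0 := Vgammahat_ge0 sg1 loew S0.
pose delta := Num.sqrt D * (M / Num.sqrt s) * (Num.sqrt H%:R / Num.sqrt N%:R).
have Nr : 0 < N%:R :> R by rewrite ltr0n.
have Hr : 1 <= H%:R :> R by rewrite ler1n.
have sD : 0 < Num.sqrt D by rewrite sqrtr_gt0.
have ss : 0 < Num.sqrt s by rewrite sqrtr_gt0.
have sN : 0 < Num.sqrt N%:R :> R by rewrite sqrtr_gt0.
have sH : 0 < Num.sqrt H%:R :> R by rewrite sqrtr_gt0 (lt_le_trans ltr01).
have d0 : 0 < delta by rewrite /delta !mulr_gt0 ?invr_gt0.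
have al_le i q : nrm (mxform (invmx (Vgammahat Nq Y F))) (unit_effect Nq Y F i q) <= delta.
  apply: (unit_effect_le Nq1 nbq sg1 loew Fsup Feig large c0 c'0 nb0 s0
    (fun q => @min_Scov_le _ _ _ Y QS q) S0 Q0 H0 i q K0 NK N0 Vu).
  by move=> j r; exact: centered_le.
apply: le_trans (prob_T_le_bound Nq1 NE N1 H0 Vu V0 t d0 al_le) _.
pose b := M / Num.sqrt s.
have b0 : 0 < b by rewrite divr_gt0.
have b2 : 1 <= 2 * b ^+ 2.
  by rewrite /b expr_div_n sqr_sqrtr ?(ltW s0) // mulrA ler_pdivlMr // mul1r.
have b3 : b <= 2 * b ^+ 3 by rewrite exprS mulrCA -[leLHS]mulr1 ler_pM2l.
have bX : b ^+ 3 <= (\big[Num.max/0]_q MN Y q ^+ 3) / s `^ (3%:R / 2).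
  rewrite /b expr_div_n mulrC.
  have -> : s `^ (3%:R / 2) = Num.sqrt s ^+ 3.
    by rewrite -powR12_sqrt ?(ltW s0) // -powR_mulrn ?powR_ge0 // -powRrM; congr (_ `^ _); ring.
  rewrite [leRHS]mulrC ler_pM2l ?invr_gt0 ?exprn_gt0 //; exact: max_MN_cube.
have HX : H%:R ^+ 3 * Num.sqrt H%:R <= H%:R `^ (19%:R / 4) :> R.
  have H00 : H%:R != 0 :> R by rewrite gt_eqF // (lt_le_trans ltr01).
  rewrite -powR12_sqrt // -powR_mulrn // -powRD; last by rewrite H00 implybT.
  by apply: ler_powR => //; lra.
rewrite /delta -/b.
have -> : 16 * bootstrap_const R * H%:R ^+ 3 * (12 * (Num.sqrt D * b * (Num.sqrt H%:R / Num.sqrt N%:R)))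
  = 192 * bootstrap_const R * Num.sqrt D * b * (H%:R ^+ 3 * Num.sqrt H%:R / Num.sqrt N%:R) by ring.
apply: ler_pM.
- by rewrite !mulr_ge0 // ltW.
- by rewrite !mulr_ge0 ?invr_ge0 ?exprn_ge0 // ltW.
- have -> : 384 * bootstrap_const R * Num.sqrt D = 192 * bootstrap_const R * Num.sqrt D * 2 by ring.
  rewrite -[leRHS]mulrA ler_wpM2l //; first by rewrite !mulr_ge0 // ltW.
  by apply: le_trans b3 _; rewrite ler_pM2l.
by rewrite ler_pM2r ?invr_gt0.
Qed.
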